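(* Let $(X_1,T_1)$ and $(X_2,T_2)$ be minimal Cantor systems. If $(X_1,T_1)$ and $(X_2,T_2)$ are orbit equivalent, then $(X_1,T_1)$ and $(X_2,T_2)$ are speedup equivalent.
   Context: A Cantor space is a nonempty compact, metrizable, perfect, zero-dimensional space. A minimal Cantor system $(X,T)$ is a Cantor space $X$ together with a homeomorphism $T:X\to X$ all of whose orbits are dense. Speedup: $(X_2,T_2)$ is a speedup of $(X_1,T_1)$ if $(X_2,T_2)$ is topologically conjugate to $(X_1,S)$ for some minimal homeomorphism $S$ of $X_1$ of the form $S(x)=T_1^{p(x)}(x)$, where $p:X_1\to\mathbb{Z}^+$ is a function into the positive integers. Two systems are speedup equivalent if each is a speedup of the other. Orbit equivalence: $(X_1,T_1)$ and $(X_2,T_2)$ are orbit equivalent if there is a homeomorphism $F:X_1\to X_2$ with $F(\{T_1^n(x):n\in\mathbb{Z}\})=\{T_2^n(F(x)):n\in\mathbb{Z}\}$ for every $x\in X_1$. *)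

(* Defs.v *)
From mathcomp Require Import all_boot all_order all_algebra.
From mathcomp Require Import all_classical all_reals topology.

Set Implicit Arguments.
Unset Strict Implicit.
Unset Printing Implicit Defensive.

Import Order.TTheory GRing.Theory Num.Theory.

Local Open Scope classical_set_scope.

Record homeo (X Y : topologicalType) := Homeo {
  homeo_fun :> X -> Y ;
  homeo_inv : Y -> X ;
  homeo_funK : cancel homeo_fun homeo_inv ;
  homeo_invK : cancel homeo_inv homeo_fun ;
  homeo_fun_continuous : continuous homeo_fun ;
  homeo_inv_continuous : continuous homeo_inv
}.

Definition metrizable (R : realType) (X : topologicalType) : Prop :=
  exists M : metricType R, inhabited (homeo X M).

(* Zero-dimensionality is the existence of a base of clopen sets; [topology]'s
   [zero_dimensional] only asks that clopen sets separate points, which is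
   weaker in general and equivalent for compact Hausdorff spaces. *)
Definition is_cantor_space (R : realType) (X : topologicalType) : Prop :=
  [/\ [set: X] !=set0, compact [set: X], metrizable R X,
      perfect_set [set: X] & basis (@clopen X)].

(* [Negz k] stands for the integer -(k+1). *)
Definition ziter (X : topologicalType) (T : homeo X X) (n : int) : X -> X :=
  match n with
  | Posz k => iter k T
  | Negz k => iter k.+1 (homeo_inv T)
  end.

Definition zorbit (X : topologicalType) (T : homeo X X) (x : X) : set X :=
  [set ziter T n x | n in [set: int]].

Definition minimal_homeo (X : topologicalType) (T : homeo X X) : Prop :=
  forall x : X, dense (zorbit T x).

Definition minimal_cantor_system (R : realType) (X : topologicalType)
    (T : homeo X X) : Prop :=
  is_cantor_space R X /\ minimal_homeo T.

Definition conjugate (X Y : topologicalType) (T : homeo X X) (S : homeo Y Y) :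
    Prop :=
  exists h : homeo X Y, forall x : X, h (T x) = S (h x).

(* [is_speedup T2 T1]: the system of [T2] is a speedup of that of [T1]. The jump
   function [p] is not required to be continuous. *)
Definition is_speedup (X2 X1 : topologicalType) (T2 : homeo X2 X2)
    (T1 : homeo X1 X1) : Prop :=
  exists (S : homeo X1 X1) (p : X1 -> nat),
    [/\ minimal_homeo S, (forall x, (0 < p x)%N),
        (forall x, S x = iter (p x) T1 x) & conjugate T2 S].

Definition speedup_equivalent (X1 X2 : topologicalType) (T1 : homeo X1 X1)
    (T2 : homeo X2 X2) : Prop :=
  is_speedup T1 T2 /\ is_speedup T2 T1.

Definition orbit_equivalent (X1 X2 : topologicalType) (T1 : homeo X1 X1)
    (T2 : homeo X2 X2) : Prop :=
  exists F : homeo X1 X2, forall x : X1, F @` zorbit T1 x = zorbit T2 (F x).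

(* Main.v *)
(* Transporting T2 by the orbit equivalence gives a homeomorphism U of X = X1 with
   the same orbits as T = T1; one looks for a homeomorphism h of X such that h (U x)
   lies strictly ahead of h x on its T-orbit, for every x. Then S = h U h^-1 is a
   speedup of T conjugate to T2.

   Since an orbit-preserving homeomorphism between clopen sets is a countable union
   of powers of T on closed pieces, it preserves all T-invariant measures. Conversely
   (Glasner-Weiss), if two nonempty clopen sets have the same measure for every
   invariant measure, then one is carried onto the other by a homeomorphism that
   moves every point strictly forward on its T-orbit; its jump is discontinuous at a
   single point, which can be prescribed together with its image.

   Fix x0 and z0 = U^-1 x0. A sequence of orbit-preserving homeomorphisms h_n and of
   clopen sets B_n shrinking to x0 is built so that h_n (U x) is ahead of h_n x
   unless U x lies in B_n. At each step h_n is composed with a homeomorphism g that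
   preserves the levels of a fine tower of U over B_(n+1), commutes with U off B_n,
   and is obtained by replacing the passages of U through B_n by forward maps, which
   exist since consecutive levels have the same measures. The levels being fine, h_n
   and its inverse converge. As x0 and z0 are fixed by every g, the last condition,
   that h x0 be ahead of h z0, only depends on h_0. *)

Require Import Defs.
From HB Require Import structures.
From mathcomp Require Import all_boot all_order all_algebra.
From mathcomp Require Import all_classical all_reals topology normedtype sequences.
From mathcomp Require Import zify ring lra.

Set Implicit Arguments.
Unset Strict Implicit.
Unset Printing Implicit Defensive.

Import Order.TTheory GRing.Theory Num.Theory.
Import numFieldNormedType.Exports.

Local Open Scope classical_set_scope.

(** * Homeomorphisms and orbits *)

Section Homeo.

Lemma homeo_cts (X Y : topologicalType) (h : homeo X Y) x : {for x, continuous h}.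
Proof. by case: h => f g ? ? cf ?; exact: cf. Qed.

Definition hinv (X Y : topologicalType) (h : homeo X Y) : homeo Y X :=
  Homeo (homeo_invK h) (homeo_funK h)
    (@homeo_inv_continuous _ _ h) (@homeo_fun_continuous _ _ h).

Definition hcomp (X Y Z : topologicalType) (g : homeo Y Z) (f : homeo X Y) :
  homeo X Z.
Proof.
exists (g \o f) (hinv f \o hinv g).
- by move=> x /=; rewrite !homeo_funK.
- by move=> x /=; rewrite !homeo_invK.
- by move=> x; apply: (@continuous_comp _ _ _ f g); exact: homeo_cts.
- by move=> x; apply: (@continuous_comp _ _ _ (hinv g) (hinv f)); exact: homeo_cts.
Defined.

Variables (X Y : topologicalType) (h : homeo X Y).

Lemma homeo_inj : injective h.
Proof. exact: can_inj (homeo_funK h). Qed.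

Lemma hinvK x : h (hinv h x) = x. Proof. exact: homeo_invK. Qed.

Lemma homeoK x : hinv h (h x) = x. Proof. exact: homeo_funK. Qed.

Lemma homeo_clopen (C : set Y) : clopen C -> clopen (h @^-1` C).
Proof. by move=> cC; apply: preimage_clopen => //; move=> x; exact: homeo_cts. Qed.

End Homeo.

Section Iterates.
Variables (X : topologicalType) (T : homeo X X).

Lemma iter_cts n : continuous (iter n T).
Proof.
elim: n => [|n IH] x; first exact: cvg_id.
by apply: (@continuous_comp _ _ _ (iter n T) T); [exact: IH|exact: homeo_cts].
Qed.

Lemma zitersn (n : nat) x : ziter (hinv T) n x = ziter T (- n%:Z)%R x.
Proof. by case: n => //= n; rewrite NegzE. Qed.

Lemma ziter_hinv (n : int) x : ziter (hinv T) n x = ziter T (- n)%R x.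
Proof.
case: n => n; first by rewrite zitersn.
rewrite NegzE opprK /=; elim: n => //= n ->; congr (T (T _)).
Qed.

Lemma ziterS (n : int) x : ziter T (n + 1)%R x = T (ziter T n x).
Proof.
case: n => n; first by rewrite -PoszD addn1.
case: n => [|n]; first by rewrite NegzE addNr /= homeo_invK.
have -> : (Negz n.+1 + 1 = Negz n)%R by rewrite !NegzE; lia.
by rewrite /= homeo_invK.
Qed.

Lemma ziterP (n : int) x : ziter T (n - 1)%R x = hinv T (ziter T n x).
Proof. by rewrite -{2}(subrK 1%R n) ziterS homeoK. Qed.

Lemma ziterD (m n : int) x : ziter T (m + n)%R x = ziter T m (ziter T n x).
Proof.
elim: m => [|m IH|m IH]; first by rewrite add0r.
  by rewrite -addn1 PoszD addrAC ziterS IH ziterS.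
have -> : (- m.+1%:Z + n = (- m%:Z + n) - 1)%R by lia.
rewrite ziterP IH -ziterP; congr ziter; lia.
Qed.

Lemma ziterNK (n : int) : cancel (ziter T n) (ziter T (- n)%R).
Proof. by move=> x; rewrite -ziterD addNr. Qed.

Lemma ziterKN (n : int) : cancel (ziter T (- n)%R) (ziter T n).
Proof. by move=> x; rewrite -ziterD subrr. Qed.

Lemma ziter_cts (n : int) : continuous (ziter T n).
Proof.
case: n => n; first exact: iter_cts.
elim: n => [|n IH] x; first exact: homeo_inv_continuous.
apply: (@continuous_comp _ _ _ (iter n.+1 (hinv T)) (hinv T)); first exact: IH.
exact: homeo_cts.
Qed.

Definition orb (x y : X) := exists n : int, y = ziter T n x.

Definition fwd (x y : X) := exists n : nat, y = iter n.+1 T x.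

Lemma orb_refl x : orb x x. Proof. by exists 0%R. Qed.

Lemma orb_sym x y : orb x y -> orb y x.
Proof. by move=> [n ->]; exists (- n)%R; rewrite ziterNK. Qed.

Lemma orb_trans y x z : orb x y -> orb y z -> orb x z.
Proof. by move=> [n ->] [m ->]; exists (m + n)%R; rewrite ziterD. Qed.

Lemma orb_step x : orb x (T x). Proof. by exists 1%R. Qed.

Lemma fwd_orb x y : fwd x y -> orb x y.
Proof. by move=> [n ->]; exists (Posz n.+1). Qed.

Lemma zorbitP x y : zorbit T x y <-> orb x y.
Proof.
by split => [[n _ <-]|[n ->]]; [exists n|exists n].
Qed.

End Iterates.

Lemma orb_hinv (X : topologicalType) (T : homeo X X) x y :
  orb (hinv T) x y <-> orb T x y.
Proof.
split=> -[n ->]; first by exists (- n)%R; rewrite ziter_hinv.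
by exists (- n)%R; rewrite ziter_hinv opprK.
Qed.

Lemma fwd_hinv (X : topologicalType) (T : homeo X X) x y :
  fwd (hinv T) x y <-> fwd T y x.
Proof.
split=> -[n ->]; exists n.
  have := ziterKN T (Posz n.+1) x; rewrite -ziter_hinv => E; exact: esym E.
have := ziterNK T (Posz n.+1) y; rewrite -ziter_hinv => E; exact: esym E.
Qed.

Section Least.

(* Equal to 0 when P is empty. *)
Definition least (P : nat -> Prop) : nat :=
  xget 0%N [set n | P n /\ forall k, (k < n)%N -> ~ P k].

Lemma least_eq (P : nat -> Prop) n :
  P n -> (forall k, (k < n)%N -> ~ P k) -> least P = n.
Proof.
move=> Pn Pk; apply: xget_unique => // m [Pm Pl].
have [mn|nm|//] := ltngtP m n; first by case: (Pk _ mn).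
by case: (Pl _ nm).
Qed.

Lemma leastP (P : nat -> Prop) : (exists n, P n) ->
  P (least P) /\ forall k, (k < least P)%N -> ~ P k.
Proof.
move=> [n Pn]; have exP : exists n, `[< P n >] by exists n; apply/asboolP.
case: (ex_minnP exP) => m /asboolP Pm mP.
have mP' k : (k < m)%N -> ~ P k.
  by move=> km Pk; move: km; rewrite ltnNge mP //; apply/asboolP.
by rewrite (least_eq Pm mP').
Qed.

End Least.

(** * Locally constant functions and clopen sets *)

Definition loccst (X : topologicalType) (A : Type) (c : X -> A) :=
  forall x, \forall y \near x, c y = c x.

Section Locally.
Variable X : topologicalType.

Lemma clopen_loccst (C : set X) : clopen C -> loccst C.
Proof.
move=> [oC cC] x; have [Cx|nCx] := pselect (C x).
  have := open_nbhs_nbhs (conj oC Cx); apply: filterS => y Cy.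
  by apply/propext; split.
have := open_nbhs_nbhs (conj (closed_openC cC) nCx); apply: filterS => y Cy.
by apply/propext; split.
Qed.

Lemma loccst_clopen (C : set X) : loccst C -> clopen C.
Proof.
move=> lC; split; first by rewrite openE => x Cx; apply: filterS (lC x) => y ->.
rewrite -openC openE => x Cx; apply: filterS (lC x) => y /= Ey.
by move=> Cy; apply: Cx; rewrite -Ey.
Qed.

Lemma loccst_fiber (A : Type) (c : X -> A) a : loccst c -> clopen [set x | c x = a].
Proof. by move=> lc; apply: loccst_clopen => x; apply: filterS (lc x) => y /= ->. Qed.

Lemma loccst_cts (Y : topologicalType) (A : Type) (f : X -> Y) (c : Y -> A) :
  continuous f -> loccst c -> loccst (c \o f).
Proof. by move=> cf lc x; exact: (cf x _ (lc (f x))). Qed.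

Lemma loccst_lt (A : Type) (c : nat -> X -> A) n x : (forall i, loccst (c i)) ->
  \forall y \near x, forall i, (i < n)%N -> c i y = c i x.
Proof.
move=> lc; elim: n => [|n IH]; first by apply: nearW.
apply: filterS2 IH (lc n x) => y IH En i; rewrite ltnS leq_eqVlt.
by case/predU1P => [->//|]; apply: IH.
Qed.

(** A least index [n] is decided by the finitely many clopen sets [P 0], ..., [P n]. *)
Lemma least_near (P : nat -> set X) x : (forall n, clopen (P n)) ->
  (exists n, P n x) -> \forall y \near x, least (P ^~ y) = least (P ^~ x).
Proof.
move=> cP eP; have [Pn Pk] := leastP eP.
have := @loccst_lt _ P (least (P ^~ x)).+1 x (fun i => clopen_loccst (cP i)).
apply: filterS => y E; apply: least_eq => /= [|k kn]; first by rewrite E.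
by rewrite E; [exact: Pk | exact: ltnW].
Qed.

Lemma cts_near (Y : topologicalType) (f g : X -> Y) x :
  (\forall y \near x, f y = g y) -> {for x, continuous g} -> {for x, continuous f}.
Proof.
move=> E cg U; rewrite (nbhs_singleton E) => /cg; rewrite /= !nbhs_simpl /=.
by move=> gU; apply: filterS2 E gU => y /= ->.
Qed.

End Locally.

(** Countability of the clopen algebra stands in for the metric: the inductive constructions treat
    the sets [W n] one after the other. *)
Record cantor_enum (X : topologicalType) (W : nat -> set X) : Prop := CantorEnum {
  ce_compact : compact [set: X] ;
  ce_clopen : forall n, clopen (W n) ;
  ce_surj : forall C : set X, clopen C -> exists n, W n = C ;
  ce_base : forall (x : X) (O : set X), open O -> O x ->
    exists C, [/\ clopen C, C x & C `<=` O] ;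
  ce_hausdorff : hausdorff_space X ;
  ce_perfect : forall x : X, ~ open [set x] }.

Section CantorEnum.
Variables (X : topologicalType) (W : nat -> set X).
Hypothesis hW : cantor_enum W.

Lemma compact_cover_nat (K : set X) (C : nat -> set X) : closed K ->
  (forall n, open (C n)) -> K `<=` \bigcup_n C n ->
  exists N, forall x, K x -> exists2 n, (n < N)%N & C n x.
Proof.
move=> cK oC KC.
have /compact_near_coveringP ncK : compact K.
  by apply: subclosed_compact (ce_compact hW) _ => //.
pose P N x := exists2 n, (n < N)%N & C n x.
have PN x : K x -> \forall x' \near x & N \near \oo, P N x'.
  move=> /KC [n _ Cn].
  refine (ex_intro2 _ _ (C n, [set N | (n < N)%N]) _ _) => /=.
    by split; [exact: open_nbhs_nbhs|exact: nbhs_infty_gt].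
  by move=> [y N] /= [Cy nN]; exists n.
have [N _ NP] := ncK nat \oo P _ PN.
by exists N; exact: (NP N (leqnn N)).
Qed.

Lemma clopen_sep (x y : X) : x <> y -> exists C, [/\ clopen C, C x & ~ C y].
Proof.
move=> /eqP xy; have := ce_hausdorff hW; rewrite open_hausdorff.
move=> /(_ x y xy) [[A B] /= [/set_mem Ax /set_mem By] [oA oB /eqP AB]].
have [C [cC Cx CA]] := ce_base hW oA Ax.
exists C; split => // Cy; suff: set0 y by []. 
by rewrite -AB; split => //; apply: CA.
Qed.

(** The clopen sets disjoint from [L] cover [K], and [W] makes this cover countable; a finite
    subcover is enough. *)
Lemma closed_sep (K L : set X) : closed K -> closed L -> K `&` L = set0 ->
  exists C, [/\ clopen C, K `<=` C & C `&` L = set0].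
Proof.
move=> cK cL KL.
pose D n := if `[< W n `&` L = set0 >] then W n else set0.
have cD n : clopen (D n).
  by rewrite /D; case: ifP => _; [exact: (ce_clopen hW n)|exact: clopen0].
have [|N NP] := compact_cover_nat cK (fun n => proj1 (cD n)).
  move=> x Kx; have nL : (~` L) x by move=> Lx; suff: set0 x by []; rewrite -KL.
  have [C [cC Cx CL]] := ce_base hW (closed_openC cL) nL.
  have [n En] := ce_surj hW cC; exists n => //; rewrite /D.
  rewrite En asboolT //; apply/seteqP; split => // z [Cz Lz]; exact: (CL z).
exists (\big[setU/set0]_(i < N) D i); split.
- by elim/big_ind: _ => // [|A B]; [exact: clopen0|exact: clopenU].
- by move=> x /NP [n nN Dn]; rewrite -bigcup_mkord; exists n.
apply/seteqP; split => // z []; rewrite -bigcup_mkord => -[n _].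
rewrite /D; case: ifP => // /asboolP E Wz Lz; suff: set0 z by [].
by rewrite -E.
Qed.

(** The limit is a cluster point given by compactness: each clopen neighbourhood of it meets every
    tail of the sequence. *)
Lemma cluster_lim (u : nat -> X) : (forall C, clopen C ->
    exists N, forall n, (N <= n)%N -> C (u n) = C (u N)) ->
  exists l, forall C, clopen C -> exists N, forall n, (N <= n)%N -> C (u n) = C l.
Proof.
move=> uC; have [l [_ cl]] := ce_compact hW (fmap_proper_filter u _) (filterT : (u @ \oo) setT).
exists l => C cC; have [N NP] := uC C cC; exists N => n Nn; rewrite NP //.
have tail : (u @ \oo) [set u n | n in [set n | (N <= n)%N]].
  by exists N => // k /= Nk; exists k.
apply/propext; split => [CN|Cl].
  apply: contrapT => nCl.
  have [z [[k /= Nk <-]]] :=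
    cl _ (~` C) tail (open_nbhs_nbhs (conj (closed_openC (proj2 cC)) nCl)).
  by rewrite /setC /= NP.
have [z [[k /= Nk <-]]] := cl _ C tail (open_nbhs_nbhs (conj (proj1 cC) Cl)).
by rewrite NP.
Qed.

Lemma cts_clopen (f : X -> X) x :
  (forall C, clopen C -> C (f x) -> \forall y \near x, C (f y)) ->
  {for x, continuous f}.
Proof.
move=> H U; rewrite /= nbhsE => -[O [oO Ofx] OU].
have [C [cC Cx CO]] := ce_base hW oO Ofx.
by apply: (filterS _ (H C cC Cx)) => y Cy; apply/OU/CO.
Qed.

Lemma clopen_eq (x y : X) : (forall C, clopen C -> C x -> C y) -> x = y.
Proof.
move=> H; apply: contrapT => xy; have [C [cC Cx nCy]] := clopen_sep xy.
by apply: nCy; apply: H.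
Qed.

End CantorEnum.

(** * Minimal homeomorphisms *)

Section Minimal.
Variables (X : topologicalType) (W : nat -> set X) (T : homeo X X).
Hypotheses (hW : cantor_enum W) (hT : minimal_homeo T).

Lemma orbit_hit x (O : set X) y : open O -> O y -> exists n : int, O (ziter T n x).
Proof.
move=> oO Oy; have [z [Oz [n _ nz]]] := hT x (ex_intro _ y Oy) oO.
by exists n; rewrite nz.
Qed.

(** Compactness bounds by some [N] the time needed to reach [O] from any point, in one direction or
    the other. Starting from [iter N.+1 T x] makes the total time positive. *)
Lemma fwd_hit x (O : set X) y : open O -> O y -> exists z, O z /\ fwd T x z.
Proof.
move=> oO Oy.
pose C (k : nat) := ziter T k @^-1` O `|` ziter T (- k%:Z)%R @^-1` O.
have [|z _|N NP] := compact_cover_nat hW (K := setT) closedT (C := C).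
- move=> n; apply: openU; apply: open_comp => // z _; exact: ziter_cts.
- have [n On] := orbit_hit z oO Oy; exists `|n|%N => //.
  by case: n On => n On; [left|right; rewrite NegzE in On].
have [n nN Cn] := NP (iter N.+1 T x) I.
have [] : O (ziter T n%:Z (ziter T (Posz N.+1) x)) \/
    O (ziter T (- n%:Z)%R (ziter T (Posz N.+1) x)) by exact: Cn.
  all: rewrite -ziterD => On.
  exists (ziter T (n%:Z + Posz N.+1)%R x); split => //.
  by exists (n + N)%N; rewrite -PoszD addnS.
exists (ziter T (- n%:Z + Posz N.+1)%R x); split => //.
exists (N - n)%N; have -> : (- n%:Z + Posz N.+1 = Posz (N - n).+1)%R by lia.
by [].
Qed.

(** A periodic orbit is finite, hence closed; being dense, it is the whole space, so that points are
    open, against perfectness. *)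
Lemma aperiodic x y : fwd T x y -> x <> y.
Proof.
move=> [n ->] /esym per.
pose F := [set iter i T x | i in `I_n.+1].
have orbF m : F (ziter T m x).
  elim: m => [|m [i ilt E]|m [i ilt E]]; first by exists 0%N.
    rewrite -addn1 PoszD ziterS -E; move: ilt; rewrite /= ltnS leq_eqVlt.
    by case/predU1P => [->|ilt]; [exists 0%N => //=; rewrite -per|exists i.+1].
  have -> : (- m.+1%:Z = - m%:Z - 1)%R by lia.
  rewrite ziterP -E; case: i ilt {E} => [|i] ilt /=.
    by exists n => //=; apply: (@homeo_inj _ _ T); rewrite hinvK.
  by exists i => /=; [exact: ltnW|rewrite homeo_funK].
have finF : finite_set F by exact: finite_image.
have clF (G : set X) : finite_set G -> closed G.
  by move=> fG; exact: (compact_closed (ce_hausdorff hW) (finite_compact fG)).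
have FT z : F z.
  apply: contrapT => nFz; have [m] := orbit_hit x (closed_openC (clF _ finF)) nFz.
  by apply.
apply: (ce_perfect hW (x := x)); rewrite -closedC.
apply: clF; apply: (sub_finite_set _ finF) => z _; exact: FT.
Qed.

Lemma ziter_inj x (m n : int) : ziter T m x = ziter T n x -> m = n.
Proof.
wlog mn : m n / (m < n)%R.
  move=> H; have [mn|nm|//] := ltgtP m n; first exact: H.
  by move=> /esym; move/(H _ _ nm).
move=> E; exfalso.
have [k Ek] : exists k : nat, (n - m)%R = Posz k.+1 by exists `|n - m|.-1; lia.
apply: (@aperiodic x (iter k.+1 T x)); first by exists k.
rewrite -[iter _ _ _]/(ziter T (Posz k.+1) x) -Ek addrC ziterD -E.
by rewrite ziterNK.
Qed.

End Minimal.

(** * Homeomorphisms between clopen sets *)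

Section PartialHomeo.
Variable X : topologicalType.

(** [f] and [g] are total, but only their restrictions to [A] and [B] matter. Continuity is taken in
    [X], which agrees with relative continuity when the sets are open. *)
Record phomeo (A B : set X) (f g : X -> X) : Prop := PHomeo {
  ph_f : forall x, A x -> B (f x) ;
  ph_g : forall y, B y -> A (g y) ;
  ph_fK : forall x, A x -> g (f x) = x ;
  ph_gK : forall y, B y -> f (g y) = y ;
  ph_fc : forall x, A x -> {for x, continuous f} ;
  ph_gc : forall y, B y -> {for y, continuous g} }.

Lemma phomeo_sym A B f g : phomeo A B f g -> phomeo B A g f.
Proof. by case. Qed.

Definition phomeo_in (R : X -> X -> Prop) (A B : set X) :=
  exists f g, phomeo A B f g /\ forall x, A x -> R x (f x).

Lemma phomeo_in_sym R A B :
  phomeo_in R A B -> phomeo_in (fun x y => R y x) B A.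
Proof.
move=> [f [g [fg fR]]]; exists g, f; split; first exact: phomeo_sym.
by move=> y By; rewrite -{2}(ph_gK fg By); apply/fR/(ph_g fg).
Qed.

(** As the labels [a] and [b] are locally constant, the glued maps coincide near each point with a
    single piece. *)
Lemma phomeo_glue (R : X -> X -> Prop) (I : Type) (a b : X -> I) (A B : set X) :
  (forall x, A x -> \forall y \near x, a y = a x) ->
  (forall x, B x -> \forall y \near x, b y = b x) ->
  (forall i, phomeo_in R (A `&` [set x | a x = i]) (B `&` [set x | b x = i])) ->
  phomeo_in R A B.
Proof.
move=> la lb H.
have /choice [F] : forall i, exists fg : (X -> X) * (X -> X),
    phomeo (A `&` [set x | a x = i]) (B `&` [set x | b x = i]) fg.1 fg.2 /\
    forall x, (A `&` [set x | a x = i]) x -> R x (fg.1 x).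
  by move=> i; have [f [g fgP]] := H i; exists (f, g).
move=> FP; pose f x := (F (a x)).1 x; pose g y := (F (b y)).2 y.
have fB x : A x -> B (f x) /\ b (f x) = a x.
  by move=> Ax; apply: (ph_f (proj1 (FP (a x)))).
have gA x : B x -> A (g x) /\ a (g x) = b x.
  by move=> Bx; apply: (ph_g (proj1 (FP (b x)))).
exists f, g; split; last by move=> x Ax; apply: (proj2 (FP (a x))).
split.
- by move=> x /fB [].
- by move=> x /gA [].
- move=> x Ax; rewrite /g (proj2 (fB x Ax)).
  exact: (ph_fK (proj1 (FP (a x)))).
- move=> x Bx; rewrite /f (proj2 (gA x Bx)).
  exact: (ph_gK (proj1 (FP (b x)))).
- move=> x Ax; apply: (@cts_near _ _ _ (F (a x)).1).
    by apply: filterS (la x Ax) => y; rewrite /f => ->.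
  exact: (ph_fc (proj1 (FP (a x)))).
- move=> x Bx; apply: (@cts_near _ _ _ (F (b x)).2).
    by apply: filterS (lb x Bx) => y; rewrite /g => ->.
  exact: (ph_gc (proj1 (FP (b x)))).
Qed.

End PartialHomeo.

(** * Invariant measures *)

Section States.
Variables (R : realType) (X : topologicalType) (W : nat -> set X) (T : homeo X X).
Hypotheses (hW : cantor_enum W).
Local Open Scope ring_scope.

(* Invariant probability measures, seen as finitely additive functions of
   clopen sets. *)
Record is_state (m : set X -> R) : Prop := IsState {
  st_T : m setT = 1 ;
  st_ge0 : forall A, clopen A -> 0 <= m A ;
  st_add : forall A B, clopen A -> clopen B -> A `&` B = set0 ->
    m (A `|` B) = m A + m B ;
  st_inv : forall A, clopen A -> m (T @^-1` A) = m A }.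

Variable m : set X -> R.
Hypothesis hm : is_state m.

Lemma st_split A B : clopen A -> clopen B -> m A = m (A `&` B) + m (A `\` B).
Proof.
move=> cA cB; rewrite -st_add ?setUIDK //.
- exact: clopenI.
- by rewrite setDE; apply: clopenI => //; apply: clopenC.
- by rewrite setDE setIACA setICr setI0.
Qed.

Lemma st_le A B : clopen A -> clopen B -> A `<=` B -> m A <= m B.
Proof.
move=> cA cB AB; rewrite (st_split cB cA) (iffRL (setIidPr _ _) AB) lerDl; apply: st_ge0 => //.
by rewrite setDE; apply: clopenI => //; apply: clopenC.
Qed.

Lemma st_0 : m set0 = 0.
Proof.
have := st_add hm clopen0 clopen0 (setI0 (@set0 X)).
by rewrite setU0 => /eqP; rewrite -subr_eq0 opprD addrA subrr sub0r oppr_eq0 => /eqP.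
Qed.

Lemma st_subadd N (E : nat -> set X) B : clopen B -> (forall i, clopen (E i)) ->
  (forall x, B x -> exists2 i, (i < N)%N & E i x) -> m B <= \sum_(i < N) m (E i).
Proof.
move=> + cE; elim: N B => [|N IH] B cB BE.
  rewrite big_ord0 (_ : B = set0) ?st_0 //.
  by apply/seteqP; split => // x /BE [].
rewrite big_ord_recr /= (st_split cB (cE N)) addrC lerD //.
  by apply: st_le => [||x []] //; exact: clopenI.
apply: IH => [|x [/BE [i]]]; first by rewrite setDE; apply: clopenI => //; apply: clopenC.
by rewrite ltnS leq_eqVlt => /predU1P [->//|iN] Ei _; exists i.
Qed.

Lemma st_ziter n A : clopen A -> m (ziter T n @^-1` A) = m A.
Proof.
move=> cA; have cz k : clopen (ziter T k @^-1` A).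
  by apply: preimage_clopen => // x; apply: ziter_cts.
elim: n => [//|n IH|n IH].
  rewrite -IH -[in RHS](st_inv hm (cz _)); congr m; apply/funext => x.
  apply: (congr1 A (_ : ziter T (n.+1)%:Z x = ziter T n%:Z (ziter T 1 x))).
  by rewrite -ziterD -addn1 PoszD.
rewrite -IH -[in LHS](st_inv hm (cz _)); congr m; apply/funext => x.
apply: (congr1 A (_ : ziter T (- (n.+1)%:Z) (ziter T 1 x) = ziter T (- n%:Z) x)).
by rewrite -ziterD; congr (ziter T _ x); lia.
Qed.

(** By minimality and compactness, finitely many preimages of [A] cover the space, and all have the
    measure of [A]. *)
Lemma st_gt0 (hT : minimal_homeo T) A x : clopen A -> A x -> 0 < m A.
Proof.
move=> cA Ax; pose E n := iter n T @^-1` A.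
have cE n : clopen (E n).
  by apply: preimage_clopen => // y; apply: iter_cts.
have [|y _|N NP] := compact_cover_nat hW (K := setT) closedT (C := E).
- by move=> n; case: (cE n).
- have [z [Az [n zE]]] := fwd_hit hW hT y (proj1 cA) Ax.
  by exists n.+1 => //; rewrite zE in Az.
rewrite lt_neqAle st_ge0 // andbT; apply/eqP => /esym A0.
have := @st_subadd N E setT clopenT cE (fun x _ => NP x I).
rewrite st_T // (eq_bigr (fun=> 0)) ?big1 ?ler10 // => i _.
by rewrite -[RHS]A0; apply: (@st_ziter (Posz i)).
Qed.

(** The infimum of [m] over clopen supersets serves as the outer measure of [K]; [C] reaches it up
    to [e]. *)
Lemma st_outer (K : set X) (e : R) : 0 < e -> exists C, [/\ clopen C, K `<=` C &
  forall D, clopen D -> K `<=` D -> m C <= m D + e].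
Proof.
move=> e0; pose S := [set m C | C in [set C | clopen C /\ K `<=` C]].
have hS : has_inf S.
  split; first by exists (m setT), setT => //; split => //; exact: clopenT.
  by exists 0 => _ [C [cC _] <-]; apply: st_ge0.
have [_ [C [cC KC] <-] lt] := inf_adherent e0 hS.
exists C; split => // D cD KD; apply/ltW/(lt_le_trans lt); rewrite lerD2r.
by apply: ge_inf; [case: hS|exists D].
Qed.

(** Induction on [n]: a clopen set [C] separates [K n] from the earlier sets, which are handled
    inside [C], while the part of [A] outside [C] is left for [K n]. *)
Lemma st_disjoint n (K : nat -> set X) A : clopen A ->
  (forall i, closed (K i)) -> (forall i j x, K i x -> K j x -> i = j) ->
  (forall i, K i `<=` A) ->
  exists D : nat -> set X, (forall i, (i < n)%N -> clopen (D i) /\ K i `<=` D i) /\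
    \sum_(i < n) m (D i) <= m A.
Proof.
move=> cA cK; elim: n K A cA cK => [|n IH] K A cA cK dK KA.
  by exists (fun=> set0); split => //; rewrite big_ord0 st_ge0.
pose L := \big[setU/set0]_(i < n) K i.
have LK : L `&` K n = set0.
  apply/seteqP; split => // x []; rewrite /L -bigcup_mkord => -[i /= ilt Ki Kn].
  by move: ilt; rewrite (dK _ _ _ Ki Kn) ltnn.
have cL : closed L.
  by rewrite /L; elim/big_ind: _ => [|F G|i _]; [exact: closed0|exact: closedU|exact: cK].
have [C [cC LC CK]] := closed_sep hW cL (cK n) LK.
(* The sets of index at least [n] may leave [C], so they are replaced by the empty set. *)
have [||||D [DP Dm]] := IH (fun i => if (i < n)%N then K i else set0) (A `&` C).
- exact: clopenI.
- by move=> i; case: ifP => // _; exact: closed0.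
- by move=> i j x; case: ifP => // _; case: ifP => // _; exact: dK.
- move=> i x; case: ifP => // ilt Ki; split; first exact: KA Ki.
  by apply: LC; rewrite /L -bigcup_mkord; exists i.
exists (fun i => if (i < n)%N then D i else A `\` C); split; last first.
  rewrite big_ord_recr /= ltnn (st_split cA cC) lerD2r.
  by under eq_bigr do rewrite ltn_ord.
move=> i; rewrite ltnS leq_eqVlt => /predU1P [->|ilt].
  rewrite ltnn setDE; split; first by apply: clopenI => //; apply: clopenC.
  move=> x Kx; split; first exact: KA Kx.
  by move=> Cx; suff: set0 x by []; rewrite -CK.
by rewrite ilt; have := DP i ilt; rewrite ilt.
Qed.

End States.

Lemma sum_halves (R : realType) (e : R) N :
  (\sum_(i < N) (e * 2^-1 ^+ i.+1) = e - e * 2^-1 ^+ N)%R.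
Proof.
elim: N => [|N IH]; first by rewrite big_ord0 expr0 mulr1 subrr.
by rewrite big_ord_recr /= IH exprS; field.
Qed.

(** * Orbit-preserving maps and invariant measures *)

Section StatesOrbit.
Variables (R : realType) (X : topologicalType) (W : nat -> set X) (T : homeo X X).
Hypotheses (hW : cantor_enum W) (hT : minimal_homeo T).
Variables (m : set X -> R).
Hypothesis hm : is_state T m.
Local Open Scope ring_scope.

Let kk (n : nat) : int := if odd n then Negz n./2 else Posz n./2.

Let kk_inj : injective kk.
Proof.
move=> i j E; rewrite -(odd_double_half i) -(odd_double_half j); move: E.
by rewrite /kk; case: (odd i); case: (odd j) => // -[->].
Qed.

Let kk_surj k : exists n, kk n = k.
Proof.
case: k => k; first by exists k.*2; rewrite /kk odd_double doubleK.
by exists k.*2.+1; rewrite /kk /= odd_double /= uphalf_double.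
Qed.

(* The closed sets {f = T^k} partition A, so their outer measures add up to at
   most m A, while their images T^k {f = T^k} cover B. *)
Lemma st_phomeo_le (A B : set X) f g : clopen A -> clopen B -> phomeo A B f g ->
  (forall x, A x -> orb T x (f x)) -> m B <= m A.
Proof.
move=> cA cB fg fo; apply/ler_addgt0Pr => e e0.
pose K n := [set x | A x /\ f x = ziter T (kk n) x].
have cK n : closed (K n).
  (* Where [f x] differs from the translate of [x], a clopen set separates the two, and still does
     so at nearby points. *)
  rewrite -openC openE => x nKx; rewrite /interior.
  have [Ax|nAx] := pselect (A x); last first.
    apply: filterS (clopen_loccst cA x) => y Ey [Ay _].
    by apply: nAx; rewrite -Ey.
  have /(clopen_sep hW) [C [cC Cf nC]] : f x <> ziter T (kk n) x.
    by move=> E; apply: nKx.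
  have Ef : \forall y \near x, C (f y) = C (f x).
    exact: (ph_fc fg Ax (clopen_loccst cC (f x))).
  have Ez := loccst_cts (@ziter_cts _ T (kk n)) (clopen_loccst cC) x.
  apply: filterS2 Ef Ez => y /= Ey Ey' [_ E].
  by apply: nC; rewrite -Ey' -E Ey.
have dK i j x : K i x -> K j x -> i = j.
  move=> [_ Ei] [_ Ej]; apply: kk_inj; apply: (ziter_inj hW hT (x := x)).
  by rewrite -Ei -Ej.
have e2 n : 0 < e * 2^-1 ^+ n.+1 by rewrite mulr_gt0 // exprn_gt0 // invr_gt0.
have /choice [C CP] := fun n => st_outer hm (K n) (e2 n).
pose E n := ziter T (- kk n) @^-1` C n.
have cE n : clopen (E n).
  apply: preimage_clopen; first by case: (CP n).
  by move=> x; apply: ziter_cts.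
have [|y By|N NP] := compact_cover_nat hW (proj2 cB) (C := E).
- by move=> n; case: (cE n).
- have Ag := ph_g fg By; have [k Ek] := fo _ Ag; have [n En] := kk_surj k.
  have Ey : ziter T (- kk n) y = g y.
    by rewrite -{1}(ph_gK fg By) Ek -En ziterNK.
  exists n => //; rewrite /E /preimage /mkset Ey; case: (CP n) => _ KC _.
  by apply: KC; split => //; rewrite En.
have [|D [DP Dm]] := st_disjoint hW hm N cA cK dK; first by move=> i x [].
apply: le_trans (st_subadd hm cB cE NP) _.
have sume : \sum_(i < N) (e * 2^-1 ^+ i.+1) <= e.
  by rewrite sum_halves lerBlDr lerDl mulr_ge0 ?exprn_ge0 ?invr_ge0 // ltW.
apply: le_trans (lerD Dm sume); rewrite -big_split /=; apply: ler_sum => i _.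
(* By the choice of [C i], its measure exceeds that of the competitor [D i] by at most the [i]-th
   error, and these errors sum to at most [e]. *)
rewrite (st_ziter hm) //; last by case: (CP i).
have [cD KD] := DP i (ltn_ord i); by case: (CP i) => _ _; apply.
Qed.

Lemma st_phomeo (A B : set X) : clopen A -> clopen B -> phomeo_in (orb T) A B ->
  m A = m B.
Proof.
move=> cA cB AB; apply/eqP; rewrite eq_le; have [f [g [fg fo]]] := AB.
rewrite (st_phomeo_le cA cB fg fo) andbT.
have [f' [g' [fg' fo']]] := phomeo_in_sym AB.
by apply: (st_phomeo_le cB cA fg') => x Bx; apply/orb_sym/fo'.
Qed.

End StatesOrbit.

Lemma ultra_cvg (R : realType) (G : set_system nat) (u : nat -> R) :
  UltraFilter G -> (forall n, 0 <= u n <= 1)%R -> cvg (u @ G).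
Proof.
move=> UG u01; have PG := @ultra_proper _ _ UG.
have Gu : G (u @^-1` `[0%R, 1%R]%classic).
  by apply: filterE => n; rewrite /preimage /= in_itv /=; exact: u01.
have [l [_ cl]] := segment_compact (fmap_proper_filter u PG) Gu.
apply/cvg_ex; exists l => N Nl.
have [//|GN] := in_ultra_setVsetC (u @^-1` N) UG.
by have [z [nz Nz]] := cl (~` N) N GN Nl.
Qed.

(** * Empirical measures along an orbit *)

Section Visits.
Variables (X : topologicalType) (T : homeo X X).

Definition visits (A : set X) n x : nat := \sum_(i < n) `[< A (iter i T x) >].

Lemma visitsS A n x : visits A n.+1 x = (visits A n x + `[< A (iter n T x) >])%N.
Proof. by rewrite /visits big_ord_recr. Qed.

Lemma visitsT n x : visits setT n x = n.
Proof.
elim: n => [|n IH]; first by rewrite /visits big_ord0.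
by rewrite visitsS IH asboolT // addn1.
Qed.

Lemma visits_le A n x : (visits A n x <= n)%N.
Proof.
elim: n => [|n IH]; first by rewrite /visits big_ord0.
by rewrite visitsS -addn1 leq_add // leq_b1.
Qed.

Lemma visitsU A B n x : A `&` B = set0 ->
  visits (A `|` B) n x = (visits A n x + visits B n x)%N.
Proof.
move=> AB; rewrite /visits -big_split /=; apply: eq_bigr => i _.
set y := iter i T x; have nAB : ~ (A y /\ B y) by move=> ABy; suff: set0 y by []; rewrite -AB.
have [Ay|nAy] := pselect (A y); have [By|nBy] := pselect (B y).
- by case: nAB.
- by rewrite (asboolT Ay) (asboolF nBy) asboolT //; left.
- by rewrite (asboolT By) (asboolF nAy) asboolT //; right.
- by rewrite (asboolF nBy) (asboolF nAy) asboolF // => -[].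
Qed.

(** Shifting changes the count by end terms only, which vanish in the averages: hence the invariance
    of the limit measure. *)
Lemma visits_shift A n x :
  (visits (T @^-1` A) n x + `[< A x >] = visits A n.+1 x)%N.
Proof.
elim: n => [|n IH]; first by rewrite visitsS /visits !big_ord0.
by rewrite visitsS visitsS -IH addnAC.
Qed.

Lemma visitsD A m n x : visits A (m + n) x = (visits A m x + visits A n (iter m T x))%N.
Proof.
elim: n => [|n IH]; first by rewrite addn0 {3}/visits big_ord0 addn0.
by rewrite addnS !visitsS IH -iterD addnA [(n + m)%N]addnC.
Qed.

Lemma visits_loccst A n : clopen A -> loccst (visits A n).
Proof.
move=> cA; elim: n => [|n IH] x.
  by apply: nearW => y; rewrite /visits !big_ord0.
have ln := loccst_cts (@iter_cts _ T n) (clopen_loccst cA) x.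
by apply: filterS2 (IH x) ln => y Ey /= Ey'; rewrite !visitsS Ey Ey'.
Qed.

(* m is an ultrafilter limit of the empirical measures along the orbit of x. *)
Lemma visits_state (R : realType) (E F : set X) x : clopen E -> clopen F ->
  (forall n, visits F n.+1 x <= visits E n.+1 x)%N ->
  exists m : set X -> R, is_state T m /\ (m F <= m E)%R.
Proof.
move=> cE cF EF; have [G [UG subG]] := ultraFilterLemma eventually_filter.
have PG := @ultra_proper _ _ UG.
pose avg A n : R := ((visits A n.+1 x)%:R / n.+1%:R)%R.
have cavg A : cvg (avg A @ G).
  apply: ultra_cvg => n; rewrite divr_ge0 //= ler_pdivrMr ?ltr0n // mul1r ler_nat.
  exact: visits_le.
exists (fun A => lim (avg A @ G)); split; last first.
  apply: ler_lim => //; apply: nearW => n.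
  by rewrite ler_pM2r ?invr_gt0 ?ltr0n // ler_nat.
split.
- have -> : avg setT = (fun=> 1%R); last exact: lim_cst.
  by apply/funext => n; rewrite /avg visitsT divff // pnatr_eq0.
- by move=> A _; apply: limr_ge => //; apply: nearW => n; rewrite divr_ge0.
- move=> A B _ _ AB.
  have -> : avg (A `|` B) = (avg A + avg B)%R; last exact: limD.
  by apply/funext => n; rewrite /avg visitsU // natrD mulrDl.
(* The two averages differ by at most [1 / n.+1], so the difference tends to 0 along [\oo], hence
   along the finer filter [G]. *)
- move=> A _; apply/eqP; rewrite -subr_eq0; apply/eqP.
  rewrite -[LHS](@limB _ _ _ _ _ (avg (T @^-1` A)) (avg A)) //.
  apply: cvg_lim => //; apply: cvg_trans (_ : (avg (T @^-1` A) - avg A)%R @ \oo --> _).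
    by move=> U; apply: subG.
  apply: (@squeeze_cvgr _ _ _ _ (fun n => - harmonic n)%R (@harmonic R)); last 2 first.
  + by rewrite -oppr0; apply: cvgN; exact: cvg_harmonic.
  + exact: cvg_harmonic.
  apply: nearW => n.
  change (- n.+1%:R^-1 <= avg (T @^-1` A) n - avg A n <= n.+1%:R^-1)%R.
  rewrite /avg -mulrBl -[X in (X <= _ <= _)%R]mulN1r -[X in (_ <= _ <= X)%R]mul1r.
  rewrite !ler_pM2r ?invr_gt0 ?ltr0n //.
  have E1 := visits_shift A n.+1 x; rewrite (visitsS A n.+1) in E1.
  have := leq_b1 `[< A x >]; have := leq_b1 `[< A (iter n.+1 T x) >] => b1 b2.
  have h1 : ((visits (T @^-1` A) n.+1 x)%:R <= (visits A n.+1 x)%:R + 1 :> R)%R.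
    by rewrite natr1 ler_nat; lia.
  have h2 : ((visits A n.+1 x)%:R <= (visits (T @^-1` A) n.+1 x)%:R + 1 :> R)%R.
    by rewrite natr1 ler_nat; lia.
  by apply/andP; split; lra.
Qed.

End Visits.

(** * Comparison of clopen sets *)

Section Compare.
Variables (R : realType) (X : topologicalType) (W : nat -> set X) (T : homeo X X).
Hypotheses (hW : cantor_enum W) (hT : minimal_homeo T).

(** Near a point [y] of the image, the inverse is a fixed power of [T]; this makes the image open
    and the inverse continuous. The image is closed by compactness. *)
Lemma phomeo_jump (E : set X) (p : X -> nat) : clopen E -> loccst p ->
  (forall x y, E x -> E y -> iter (p x) T x = iter (p y) T y -> x = y) ->
  exists B, [/\ clopen B, (forall y, B y -> exists x, E x /\ y = iter (p x) T x) &
    phomeo_in (fun x y => y = iter (p x) T x) E B].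
Proof.
move=> cE lp inj; pose f x := iter (p x) T x; pose B := f @` E.
have cf x : {for x, continuous f}.
  apply: (@cts_near _ _ _ (iter (p x) T)); last exact: iter_cts.
  by apply: filterS (lp x) => y; rewrite /f => ->.
pose g y := xget y [set x | E x /\ f x = y].
have gE y : B y -> E (g y) /\ f (g y) = y.
  by case=> x Ex fx; rewrite /g; case: xgetP => [z -> //|/(_ x)]; case.
have gK x : E x -> g (f x) = x.
  move=> Ex; have [Eg fg] := gE (f x) (ex_intro2 _ _ x Ex erefl).
  exact: inj.
have loc y : B y -> \forall z \near y,
    E (ziter T (- (p (g y))%:Z)%R z) /\ f (ziter T (- (p (g y))%:Z)%R z) = z.
  move=> By; have [Eg fg] := gE y By; set n := p (g y).
  have yE : ziter T (- n%:Z)%R y = g y.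
    by rewrite -{1}fg /f -/n -[iter _ _ _]/(ziter T n%:Z (g y)) ziterNK.
  have l1 := loccst_cts (@ziter_cts _ T (- n%:Z)%R) (clopen_loccst cE) y.
  have l2 := loccst_cts (@ziter_cts _ T (- n%:Z)%R) lp y.
  apply: filterS2 l1 l2 => z; rewrite /= yE => -> pz; split => //.
  by rewrite /f pz; exact: (ziterKN T n%:Z z).
exists B; split.
- split.
    rewrite openE => y By; apply: filterS (loc y By) => z [Ez fz].
    by exists (ziter T (- (p (g y))%:Z)%R z).
  apply: (compact_closed (ce_hausdorff hW)); apply: continuous_compact.
    exact: continuous_subspaceT.
  by apply: subclosed_compact (ce_compact hW) _ => //; case: cE.
- by move=> y [x Ex <-]; exists x.
exists f, g; split => //; split => //.
- by move=> x Ex; exists x.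
- by move=> y /gE [].
- by move=> y /gE [].
- move=> y By; apply: (@cts_near _ _ _ (ziter T (- (p (g y))%:Z)%R)).
    apply: filterS (loc y By) => z [Ez fz]; rewrite -{1}fz; exact: gK.
  exact: ziter_cts.
Qed.

(* Reading an orbit from left to right, with the points of F as closing and the
   points of E as opening parentheses, each point of E is sent to the matching
   point of F; this is injective. *)
Lemma strict_embed (E F : set X) : clopen E -> clopen F ->
  (forall m : set X -> R, is_state T m -> (m E < m F)%R) ->
  exists B, [/\ clopen B, B `<=` F & phomeo_in (fwd T) E B].
Proof.
(* Replacing [F] by its preimage counts closings one step later than openings, so that a match is
   always strictly ahead. *)
move=> cE cF EF; pose F' := T @^-1` F.
have cF' : clopen F' by exact: homeo_clopen.
pose P n : set X := [set x | (visits T E n.+1 x <= visits T F' n.+1 x)%N].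
have cP n : clopen (P n).
  apply: loccst_clopen => x.
  apply: filterS2 (@visits_loccst _ T E n.+1 cE x)
    (@visits_loccst _ T F' n.+1 cF' x) => y.
  by rewrite /P /= => -> ->.
(* If the openings stayed in excess forever, a limit of empirical measures along the orbit would
   give [F] at most the measure of [E]. *)
have eP x : exists n, P n x.
  apply: contrapT => /forallNP nP.
  have [n|m [hm]] := @visits_state X T R E F' x cE cF'.
    by have /negP := nP n; rewrite -ltnNge => /ltnW.
  by rewrite (st_inv hm) // leNgt EF.
pose p x := (least (P ^~ x)).+1.
have lp : loccst p.
  by move=> x; apply: filterS (least_near cP (eP x)) => y; rewrite /p => ->.
have pP x : (visits T E (p x) x <= visits T F' (p x) x)%N.
  by have [] := leastP (eP x).
have pN x k : (0 < k < p x)%N -> (visits T F' k x < visits T E k x)%N.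
  case: k => // k /= kp; have [_ /(_ k kp)] := leastP (eP x).
  by move=> /negP; rewrite -ltnNge.
have E1 x : E x -> visits T E 1 x = 1%N.
  by move=> Ex; rewrite visitsS /visits big_ord0 /= asboolT.
(* The count of closings gains at most one per step, so it cannot overtake the openings at the first
   time it catches up. *)
have pE x : E x -> visits T E (p x) x = visits T F' (p x) x.
  move=> Ex; apply/eqP; rewrite eqn_leq pP /=.
  have := pN x (p x).-1; have : (0 < p x)%N by [].
  case: (p x) => // -[|q] _ /=.
    by rewrite E1 // => _; exact: visits_le.
  rewrite ltnS leqnn => /(_ isT).
  have := visitsS T F' q.+1 x; have := visitsS T E q.+1 x => -> ->.
  have := leq_b1 `[< F' (iter q.+1 T x) >]; lia.
have pF x : E x -> F (iter (p x) T x).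
  move=> Ex; have := pP x; have := pN x (p x).-1; have : (0 < p x)%N by [].
  case: (p x) => // -[|q] _ /=.
    rewrite E1 // => _; rewrite visitsS /visits big_ord0 /=.
    by case: asboolP.
  rewrite ltnS leqnn => /(_ isT).
  have := visitsS T F' q.+1 x; have := visitsS T E q.+1 x => -> ->.
  by case: (asboolP (F' _)) => // _; lia.
have inj x y : E x -> E y -> iter (p x) T x = iter (p y) T y -> x = y.
  wlog pxy : x y / (p y <= p x)%N.
    move=> H Ex Ey Exy; have [pxy|/ltnW pxy] := leqP (p y) (p x); first exact: H.
    by apply/esym; apply: H.
  move=> Ex Ey Exy; have Ed : (p x = p y + (p x - p y))%N by lia.
  have yE : y = iter (p x - p y) T x.
    apply: (can_inj (ziterNK T (Posz (p y)))).
    by have := Exy; rewrite {1}Ed iterD.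
  have [d0|d0] := posnP (p x - p y)%N; first by rewrite yE d0.
  (* If [y] came strictly after [x], openings would be in excess between [x] and [y], whereas the
     counts balance from [x], and from [y], up to their common image. *)
  have := pN x (p x - p y)%N; rewrite d0 /=.
  have -> : (p x - p y < p x)%N by have : (0 < p y)%N by []; lia.
  move=> /(_ isT); have := pE x Ex; have := pE y Ey.
  have := visitsD T E (p x - p y) (p y) x; have := visitsD T F' (p x - p y) (p y) x.
  rewrite -yE subnK // => -> ->; lia.
have [B [cB BE [f [g [fg fp]]]]] := phomeo_jump cE lp inj.
exists B; split => //; first by move=> y /BE [x [Ex ->]]; exact: pF.
by exists f, g; split => // x Ex; rewrite fp //; exists (least (P ^~ x)).
Qed.

(** The orbit of [y] meets [A] at two distinct points, separated by a clopen set [C]. A small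
    neighbourhood of [y] has translates in both parts of [A], so twice its positive measure is at
    most that of [A]. *)
Lemma small_clopen y (A : set X) x : clopen A -> A x ->
  exists V, [/\ clopen V, V y &
    forall m : set X -> R, is_state T m -> (m V < m A)%R].
Proof.
move=> cA Ax; have [z1 [Az1 yz]] := fwd_hit hW hT y (proj1 cA) Ax.
have [z2 [Az2 zz]] := fwd_hit hW hT z1 (proj1 cA) Ax.
have [C [cC Cz nCz]] := clopen_sep hW (aperiodic hW hT zz).
have [k1 Ek1] := fwd_orb yz; have [k2 Ek2] := orb_trans (fwd_orb yz) (fwd_orb zz).
have cAC : clopen (A `\` C) by rewrite setDE; apply: clopenI => //; exact: clopenC.
have cAC' : clopen (A `&` C) by exact: clopenI.
have cz k (D : set X) : clopen D -> clopen (ziter T k @^-1` D).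
  by move=> cD; apply: preimage_clopen => // z; exact: ziter_cts.
exists (ziter T k1 @^-1` (A `&` C) `&` ziter T k2 @^-1` (A `\` C)); split.
- by apply: clopenI; exact: cz.
- by split; rewrite /preimage /mkset -?Ek1 -?Ek2; split.
move=> m hm; set V := _ `&` _.
have cV : clopen V by apply: clopenI; exact: cz.
have V0 : (0 < m V)%R.
  apply: (st_gt0 hW hm hT cV (x := y)).
  by split; rewrite /preimage /mkset -?Ek1 -?Ek2; split.
have V1 : (m V <= m (A `&` C))%R.
  rewrite -(st_ziter hm k1 cAC'); apply: (st_le hm) => //; first exact: cz.
  by move=> z [].
have V2 : (m V <= m (A `\` C))%R.
  rewrite -(st_ziter hm k2 cAC); apply: (st_le hm) => //; first exact: cz.
  by move=> z [].
rewrite (st_split hm cA cC); lra.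
Qed.

Definition st_equiv (A B : set X) :=
  forall m : set X -> R, is_state T m -> m A = m B.

(** The part of [A] outside [C] is embedded in [B], away from a neighbourhood [V] of [y] smaller
    than [A']. This [V] keeps [y] in the remainder of [B] and leaves the strict inequality that the
    embedding requires. *)
Lemma half_exhaust (A B C : set X) x y : clopen A -> clopen B -> clopen C ->
  A x -> B y -> C x -> st_equiv A B ->
  exists A' B', [/\ clopen A' /\ clopen B', A' `<=` A `&` C /\ B' `<=` B,
    A' x /\ B' y, st_equiv A' B' & phomeo_in (fwd T) (A `\` A') (B `\` B')].
Proof.
move=> cA cB cC Ax By Cx AB; pose A' := A `&` C.
have cA' : clopen A' by exact: clopenI.
have cD (D D' : set X) : clopen D -> clopen D' -> clopen (D `\` D').
  by move=> ? ?; rewrite setDE; apply: clopenI => //; exact: clopenC.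
have [V [cV Vy mV]] := small_clopen y cA' (conj Ax Cx).
have [|J [cJ JB [f [g [fg ffwd]]]]] := strict_embed (cD _ _ cA cA') (cD _ _ cB cV).
  move=> m hm; have := mV m hm; have := AB m hm.
  rewrite (st_split hm cA cA') (st_split hm cB cV) (_ : A `&` A' = A').
    have : (m (B `&` V) <= m V)%R.
      by apply: (st_le hm) => [||z []] //; exact: clopenI.
    lra.
  by rewrite /A' setIA setIid.
have JsB : J `<=` B by move=> z /JB [].
have BJ : B `\` (B `\` J) = J.
  by rewrite setDD; apply/setIidPr.
exists A', (B `\` J); split => //.
- by split => //; exact: cD.
- by split => // z [].
- by split => //; split => // /JB [].
- move=> m hm; have mJ : m (A `\` A') = m J.
    apply: (st_phomeo hW hT hm (cD _ _ cA cA') cJ); exists f, g; split => //.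
    by move=> z Ez; apply/fwd_orb/ffwd.
  have AA' : A `&` A' = A' by rewrite /A' setIA setIid.
  have BJ' : B `&` J = J by apply/setIidPr.
  by have := AB m hm; rewrite (st_split hm cA cA') (st_split hm cB cJ) AA' BJ' mJ; lra.
by rewrite BJ; exists f, g.
Qed.

End Compare.

Lemma minimal_hinv (X : topologicalType) (T : homeo X X) :
  minimal_homeo T -> minimal_homeo (hinv T).
Proof.
move=> hT x O O0 oO; have [y [Oy yo]] := hT x O O0 oO.
exists y; split => //; apply/zorbitP; apply/orb_hinv; exact/zorbitP.
Qed.

Lemma state_hinv (R : realType) (X : topologicalType) (T : homeo X X)
    (m : set X -> R) : is_state (hinv T) m -> is_state T m.
Proof.
case=> mT m0 mD mi; split => // A cA.
rewrite -[LHS]mi; last exact: homeo_clopen.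
by congr m; apply/funext => x; rewrite /preimage /mkset hinvK.
Qed.

Lemma state_hinvE (R : realType) (X : topologicalType) (T : homeo X X)
    (m : set X -> R) : is_state (hinv T) m <-> is_state T m.
Proof.
split; first exact: state_hinv.
move=> hm; apply: (@state_hinv R X (hinv T)); move: hm.
by case=> mT m0 mD mi; split.
Qed.

(** * Forward maps between clopen sets of equal measure *)

Section Exhaust.
Variables (R : realType) (X : topologicalType) (W : nat -> set X) (T : homeo X X).
Hypotheses (hW : cantor_enum W) (hT : minimal_homeo T).

(** [half_exhaust] is applied twice, the second time with the two sets exchanged and with the
    inverse of [T]: a map going backward from [B1] to [A1] has an inverse going forward. *)
Lemma full_exhaust (A B C D : set X) x y :
  clopen A -> clopen B -> clopen C -> clopen D ->
  A x -> B y -> C x -> D y -> st_equiv R T A B ->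
  exists A' B', [/\ clopen A' /\ clopen B', A' `<=` A `&` C /\ B' `<=` B `&` D,
    A' x /\ B' y, st_equiv R T A' B' & phomeo_in (fwd T) (A `\` A') (B `\` B')].
Proof.
move=> cA cB cC cD Ax By Cx Dy AB.
have [A1 [B1 [[cA1 cB1] [AA1 BB1] [A1x B1y] AB1 h1]]] :=
  half_exhaust hW hT cA cB cC Ax By Cx AB.
have BA1 : st_equiv R (hinv T) B1 A1.
  by move=> m /state_hinvE hm; rewrite AB1.
have [B2 [A2 [[cB2 cA2] [BB2 AA2] [B2y A2x] BA2 h2]]] :=
  half_exhaust hW (minimal_hinv hT) cB1 cA1 cD B1y A1x Dy BA1.
exists A2, B2; split => //.
- by split => z; [move=> /AA2 /AA1|move=> /BB2 [/BB1]].
- by move=> m hm; rewrite BA2 //; apply/state_hinvE.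
(* The labels are the propositions [A1 z] and [B1 z]: true on the pieces of the second exhaustion,
   false on those of the first. *)
apply: (@phomeo_glue _ _ Prop A1 B1).
- by move=> z _; exact: clopen_loccst.
- by move=> z _; exact: clopen_loccst.
move=> P; have [PT|PF] := pselect P.
- have -> : (A `\` A2) `&` [set z | A1 z = P] = A1 `\` A2.
    apply/seteqP; split => z.
      by move=> [[Az nA2] /= E]; split => //; rewrite E.
    move=> [A1z nA2]; split; first by split => //; case: (AA1 z A1z).
    by apply/propext.
  have -> : (B `\` B2) `&` [set z | B1 z = P] = B1 `\` B2.
    apply/seteqP; split => z.
      by move=> [[Bz nB2] /= E]; split => //; rewrite E.
    move=> [B1z nB2]; split; first by split => //; exact: BB1.
    by apply/propext.
  have [f [g [fg ff]]] := phomeo_in_sym h2.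
  by exists f, g; split => // z Az; apply/fwd_hinv/ff.
have -> : (A `\` A2) `&` [set z | A1 z = P] = A `\` A1.
  apply/seteqP; split => z.
    by move=> [[Az nA2] /= E]; split => //; rewrite E.
  move=> [Az nA1]; split; first by split => // /AA2.
  by apply/propext.
have -> : (B `\` B2) `&` [set z | B1 z = P] = B `\` B1.
  apply/seteqP; split => z.
    by move=> [[Bz nB2] /= E]; split => //; rewrite E.
  move=> [Bz nB1]; split; first by split => // /BB2 [].
  by apply/propext.
exact: h1.
Qed.

Definition side (C : set X) x : set X := if `[< C x >] then C else ~` C.

Lemma side_clopen C x : clopen C -> clopen (side C x).
Proof. by rewrite /side; case: asboolP => // _ ?; exact: clopenC. Qed.

Lemma side_mem C x : side C x x.
Proof. by rewrite /side; case: asboolP. Qed.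

Lemma side_sub C x : C x -> side C x = C.
Proof. by move=> Cx; rewrite /side asboolT. Qed.

(* Back and forth: A and B are exhausted by pieces matched by [strict_embed],
   alternately for T and for its inverse, and the remainders shrink to x0 and y0. *)
Lemma phomeo_fwd (A B : set X) x0 y0 : clopen A -> clopen B -> A x0 -> B y0 ->
  fwd T x0 y0 -> st_equiv R T A B ->
  phomeo_in (fun x y => fwd T x y /\ (x = x0 -> y = y0)) A B.
Proof.
move=> cA cB Ax0 By0 xy0 AB.
pose inv (AB : set X * set X) := [/\ clopen AB.1, clopen AB.2, AB.1 x0, AB.2 y0 &
  st_equiv R T AB.1 AB.2].
have /choice [step stepP] : forall nAB : nat * (set X * set X), exists AB',
    inv nAB.2 -> [/\ inv AB', AB'.1 `<=` nAB.2.1 `&` side (W nAB.1) x0,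
      AB'.2 `<=` nAB.2.2 `&` side (W nAB.1) y0 &
      phomeo_in (fwd T) (nAB.2.1 `\` AB'.1) (nAB.2.2 `\` AB'.2)].
  move=> [n [A' B']] /=; have [|nI] := pselect (inv (A', B')); last by exists (A', B').
  move=> [/= cA' cB' Ax By AB'].
  have cs x : clopen (side (W n) x) by apply/side_clopen/(ce_clopen hW).
  have [A2 [B2 [[? ?] [? ?] [? ?] ? ?]]] :=
    full_exhaust cA' cB' (cs x0) (cs y0) Ax By (side_mem _ _) (side_mem _ _) AB'.
  by exists (A2, B2).
pose S := fix S n := if n is k.+1 then step (k, S k) else (A, B).
have SI n : inv (S n).
  by elim: n => [|n IH]; [split|have [] := stepP (n, S n) IH].
pose a n := (S n).1; pose b n := (S n).2.
(* Every clopen set is some [W n], so lying on the side of each [W n] that contains [x0] makes the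
   sets [a n] shrink to [x0]. *)
have aS n : a n.+1 `<=` a n `&` side (W n) x0 by have [] := stepP (n, S n) (SI n).
have bS n : b n.+1 `<=` b n `&` side (W n) y0 by have [] := stepP (n, S n) (SI n).
have abS n : phomeo_in (fwd T) (a n `\` a n.+1) (b n `\` b n.+1).
  by have [] := stepP (n, S n) (SI n).
have mono (c : nat -> set X) z (C : nat -> set X) :
    (forall n, c n.+1 `<=` c n `&` C n) -> forall i j, (i <= j)%N -> c j z -> c i z.
  move=> cS i; elim=> [|j IH]; first by rewrite leqn0 => /eqP ->.
  by rewrite leq_eqVlt => /predU1P [->//|ij] /cS [cj _]; exact: (IH ij cj).
have am z i j : (i <= j)%N -> a j z -> a i z by apply: mono aS _ _.
have bm z i j : (i <= j)%N -> b j z -> b i z by apply: mono bS _ _.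
have ca n : clopen (a n) by have [] := SI n.
have cb n : clopen (b n) by have [] := SI n.
have ax n : a n x0 by have [] := SI n.
have by_ n : b n y0 by have [] := SI n.
have shrink (c : nat -> set X) z C : (forall n, c n.+1 `<=` c n `&` side (W n) z) ->
    clopen C -> C z -> exists n, c n `<=` C.
  move=> cS cC Cz; have [n Wn] := ce_surj hW cC; exists n.+1 => w /cS [_].
  by rewrite Wn side_sub.
have out (c : nat -> set X) z w : (forall n, c n.+1 `<=` c n `&` side (W n) z) ->
    w <> z -> exists n, ~ c n.+1 w.
  move=> cS /nesym /(clopen_sep hW) [C [cC Cz nCw]].
  have [n cn] := shrink c z C cS cC Cz.
  by exists n => /cS [/cn].
pose ia z := least (fun n => ~ a n.+1 z); pose ib z := least (fun n => ~ b n.+1 z).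
have fib (c : nat -> set X) z : (forall i j, (i <= j)%N -> c j z -> c i z) ->
    c 0%N z -> (exists n, ~ c n.+1 z) ->
    forall n, least (fun n => ~ c n.+1 z) = n <-> (c n `\` c n.+1) z.
  move=> cm c0 ex n; split=> [<-|[cn ncn]].
    have [nc cl] := leastP ex; split => //; case: (least _) cl => // k.
    by move=> /(_ k (ltnSn k)) /contrapT.
  apply: least_eq => // k kn; apply; exact: cm cn.
(* Matching the nested remainders is what makes the extension, by [x0] to [y0], continuous at [x0],
   and its inverse at [y0]. *)
pose Q x y := fwd T x y /\ forall n, a n x <-> b n y.
have [f [g [fg fQ]]] : phomeo_in Q (A `\ x0) (B `\ y0).
  apply: (@phomeo_glue _ _ nat ia ib).
  - move=> z [_ zx]; apply: least_near (out _ _ _ aS zx) => n; exact: clopenC.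
  - move=> z [_ zx]; apply: least_near (out _ _ _ bS zx) => n; exact: clopenC.
  move=> n.
  have -> : (A `\ x0) `&` [set z | ia z = n] = a n `\` a n.+1.
    apply/seteqP; split => z; first move=> [[Az zx] /=].
      by move/(fib a z (am z) Az (out _ _ _ aS zx)).
    move=> az; have [an nan] := az.
    have Az : A z by exact: (am z 0%N n).
    have zx : z <> x0 by move=> zx; apply: nan; rewrite zx.
    by split => //; apply/(fib a z (am z) Az (out _ _ _ aS zx)).
  have -> : (B `\ y0) `&` [set z | ib z = n] = b n `\` b n.+1.
    apply/seteqP; split => z; first move=> [[Az zx] /=].
      by move/(fib b z (bm z) Az (out _ _ _ bS zx)).
    move=> az; have [an nan] := az.
    have Az : B z by exact: (bm z 0%N n).
    have zx : z <> y0 by move=> zx; apply: nan; rewrite zx.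
    by split => //; apply/(fib b z (bm z) Az (out _ _ _ bS zx)).
  have [f [g [fg ff]]] := abS n; exists f, g; split => // z anz.
  split; first exact: ff.
  have [bn nbn] := ph_f fg anz; have [an nan] := anz.
  move=> k; have [kn|nk] := leqP k n.
    by split => _; [exact: bm bn|exact: am an].
  by split => [/(am _ _ _ nk)|/(bm _ _ _ nk)].
pose F z := if `[< z = x0 >] then y0 else f z.
pose G z := if `[< z = y0 >] then x0 else g z.
have Fx : F x0 = y0 by rewrite /F asboolT.
have Gy : G y0 = x0 by rewrite /G asboolT.
have Fn z : z <> x0 -> F z = f z by move=> zx; rewrite /F asboolF.
have Gn z : z <> y0 -> G z = g z by move=> zx; rewrite /G asboolF.
have near_ne (z w : X) : z <> w -> \forall u \near z, u <> w.
  move=> /(clopen_sep hW) [C [cC Cz nCw]].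
  by apply: filterS (clopen_loccst cC z) => u Eu uw; apply: nCw; rewrite -uw Eu.
have QF z : A z -> Q z (F z).
  move=> Az; have [->|zx] := pselect (z = x0); first by rewrite Fx; split.
  by rewrite Fn //; apply: fQ.
have QG z : B z -> Q (G z) z.
  move=> Bz; have [->|zy] := pselect (z = y0); first by rewrite Gy; split.
  by rewrite Gn // -{2}(ph_gK fg (conj Bz zy)); apply/fQ/(ph_g fg).
exists F, G; split; last by move=> z Az; split=> [|->] //; have [] := QF z Az.
split.
- by move=> z Az; have [_ /(_ 0%N) [+ _]] := QF z Az; apply.
- by move=> z Bz; have [_ /(_ 0%N) [_]] := QG z Bz; apply.
- move=> z Az; have [->|zx] := pselect (z = x0); first by rewrite Fx.
  have [_ fy] := ph_f fg (conj Az zx).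
  by rewrite Fn // Gn //; exact: (ph_fK fg).
- move=> z Bz; have [->|zy] := pselect (z = y0); first by rewrite Gy.
  have [_ gx] := ph_g fg (conj Bz zy).
  by rewrite Gn // Fn //; exact: (ph_gK fg).
- move=> z Az; have [->|zx] := pselect (z = x0).
    apply: (cts_clopen hW) => C cC; rewrite Fx => Cy.
    have [n bC] := shrink b y0 C bS cC Cy.
    apply: filterS (clopen_loccst (ca n) x0) => w Ew; apply: bC.
    have aw : a n w by rewrite Ew.
    by have [_ /(_ n) [+ _]] := QF w (am w 0%N n isT aw); apply.
  apply: (@cts_near _ _ _ f); last exact: (ph_fc fg).
  by apply: filterS (near_ne _ _ zx) => w; exact: Fn.
- move=> z Bz; have [->|zy] := pselect (z = y0).
    apply: (cts_clopen hW) => C cC; rewrite Gy => Cx.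
    have [n aC] := shrink a x0 C aS cC Cx.
    apply: filterS (clopen_loccst (cb n) y0) => w Ew; apply: aC.
    have bw : b n w by rewrite Ew.
    by have [_ /(_ n) [_]] := QG w (bm w 0%N n isT bw); apply.
  apply: (@cts_near _ _ _ g); last exact: (ph_gc fg).
  by apply: filterS (near_ne _ _ zy) => w; exact: Gn.
Qed.

(** The given map only serves to equate the measures of [A] and [B]; the image of [x] is any point
    of [B] ahead of it. *)
Lemma phomeo_fwd_ex (A B : set X) x : clopen A -> clopen B -> A x ->
  phomeo_in (orb T) A B -> phomeo_in (fwd T) A B.
Proof.
move=> cA cB Ax AB; have [f [g [fg _]]] := AB.
have [y [By xy]] := fwd_hit hW hT x (proj1 cB) (ph_f fg Ax).
have [m hm|F [G [FG FR]]] := phomeo_fwd cA cB Ax By xy.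
  exact: (st_phomeo hW hT hm cA cB AB).
by exists F, G; split => // z /FR [].
Qed.

End Exhaust.

Section HomeoPartial.
Variable X : topologicalType.

Lemma homeo_phomeo (e : homeo X X) (A : set X) : phomeo (e @^-1` A) A e (hinv e).
Proof.
split => //.
- by move=> y Ay; rewrite /preimage /mkset hinvK.
- by move=> x _; exact: homeoK.
- by move=> y _; exact: hinvK.
- by move=> x _; exact: homeo_cts.
- by move=> y _; exact: homeo_cts.
Qed.

Lemma phomeo_conj (h : homeo X X) (A B : set X) f g : phomeo A B f g ->
  phomeo (h @^-1` A) (h @^-1` B) (hinv h \o f \o h) (hinv h \o g \o h).
Proof.
move=> [Af Bg fK gK fc gc]; split => /=.
- by move=> x /= Ax; rewrite homeo_invK; exact: Af.
- by move=> y /= By; rewrite homeo_invK; exact: Bg.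
- by move=> x /= Ax; rewrite homeo_invK fK // homeo_funK.
- by move=> x /= Ax; rewrite homeo_invK gK // homeo_funK.
- move=> x /= Ax; apply: (@continuous_comp _ _ _ h (hinv h \o f)).
    exact: homeo_cts.
  apply: (@continuous_comp _ _ _ f (hinv h)); [exact: fc|exact: homeo_cts].
- move=> x /= Ax; apply: (@continuous_comp _ _ _ h (hinv h \o g)).
    exact: homeo_cts.
  apply: (@continuous_comp _ _ _ g (hinv h)); [exact: gc|exact: homeo_cts].
Qed.

Lemma phomeo_homeo f g : phomeo [set: X] [set: X] f g ->
  exists r : homeo X X, forall x, r x = f x.
Proof.
move=> fg.
exists (@Homeo X X f g (fun x => ph_fK fg I) (fun x => ph_gK fg I)
  (fun x => @ph_fc _ _ _ _ _ fg x I) (fun x => @ph_gc _ _ _ _ _ fg x I)).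
by [].
Qed.

Lemma orb_ziter (T r : homeo X X) (n : int) x : (forall x, orb T x (r x)) ->
  orb T x (ziter r n x).
Proof.
move=> hr; elim: n => [|n IH|n IH]; first exact: orb_refl.
  by rewrite -addn1 PoszD ziterS; apply: orb_trans IH (hr _).
have -> : (- n.+1%:Z = - n%:Z - 1)%R by lia.
rewrite ziterP; apply: orb_trans IH _; apply: orb_sym.
by rewrite -{2}(hinvK r (ziter r (- n%:Z)%R x)); exact: hr.
Qed.

End HomeoPartial.

(** * Correction along a tower *)

Section Step.
Variables (R : realType) (X : topologicalType) (W : nat -> set X) (T U : homeo X X).
Hypotheses (hW : cantor_enum W) (hT : minimal_homeo T) (hU : minimal_homeo U).
Hypothesis UT : forall x, orb T x (U x).

Variables (h : homeo X X) (B B' C1 : set X) (n : nat) (V : nat -> set X).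
Hypothesis hh : forall x, orb T x (h x).
Hypothesis hP : forall x, ~ B (U x) -> fwd T (h x) (h (U x)).
Hypotheses (cB : clopen B) (cB' : clopen B') (cC1 : clopen C1).
Hypotheses (cV : forall i, clopen (V i)) (B'B : B' `<=` B) (B'ne : B' !=set0).

(* The columns of the Kakutani-Rokhlin towers of U over B' are cut so finely
   that each level, a fiber of [level] below, lies on one side of every V i. *)
Let a x := least (fun k => B' (ziter U (- k%:Z)%R x)).
(** The number of levels above [x]: it is 0 on the top level, where [U x] is back in [B'], and the
    column has [a x + b x + 1] levels. *)
Let b x := least (fun k => B' (ziter U k.+1%:Z x)).
Let base x := ziter U (- (a x)%:Z)%R x.

Let aP x : exists k : nat, B' (ziter U (- k%:Z)%R x).
Proof.
have [y By] := B'ne; have [z [Bz [k Ek]]] := fwd_hit hW (minimal_hinv hU) x (proj1 cB') By.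
by exists k.+1; rewrite -ziter_hinv; rewrite Ek in Bz.
Qed.

Let bP x : exists k : nat, B' (ziter U k.+1%:Z x).
Proof.
have [y By] := B'ne; have [z [Bz [k Ek]]] := fwd_hit hW hU x (proj1 cB') By.
by exists k; rewrite Ek in Bz.
Qed.

Let a0 x : B' x -> a x = 0%N.
Proof. by move=> Bx; apply: least_eq. Qed.

Let b0 x : B' (U x) -> b x = 0%N.
Proof. by move=> Bx; apply: least_eq. Qed.

Let b_top x : b x = 0%N -> B' (U x).
Proof. by move=> E; have [+ _] := leastP (bP x); rewrite -/(b x) E. Qed.

Let zU1 (k : int) x : ziter U k (U x) = ziter U (k + 1)%R x.
Proof. by rewrite ziterD. Qed.

Let aS x : ~ B' (U x) -> a (U x) = (a x).+1.
Proof.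
move=> nB; have [Pa la] := leastP (aP x); apply: least_eq.
  by rewrite zU1 (_ : (- _ + 1)%R = (- (a x)%:Z)%R) //; lia.
case=> [//|k] ka; change (~ B' (ziter U (- k.+1%:Z)%R (U x))).
rewrite zU1 (_ : (- _ + 1)%R = (- k%:Z)%R); last by lia.
exact: la.
Qed.

Let bS x : ~ B' (U x) -> b x = (b (U x)).+1.
Proof.
move=> nB; have [Pa la] := leastP (bP (U x)); apply: least_eq.
  by rewrite -/(b (U x)) zU1 -PoszD addn1 in Pa.
case=> [//|k] ka; change (~ B' (ziter U k.+2%:Z x)).
by have := la k ka; rewrite zU1 -PoszD addn1.
Qed.

Let baseU x : ~ B' (U x) -> base (U x) = base x.
Proof. by move=> nB; rewrite /base aS // zU1; congr ziter; lia. Qed.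

(** [B] takes the index [n], so that the cutting also decides which levels lie in [B]. *)
Let V' i := if i == n then B else V i.

(** A level is named by its position and by the itinerary of its whole column, read from the base,
    so that [U] sends levels to levels inside a column. The bounds on [j] and [i] leave finitely
    many clopen conditions, whence local constancy. *)
Let level x := ((a x, b x), (C1 (base x), fun j i : nat =>
  [/\ (j <= a x + b x)%N, (i <= n)%N & V' i (iter j U (base x))])).

Let levelU x : ~ B' (U x) ->
  level (U x) = (((level x).1.1.+1, (level x).1.2.-1), (level x).2).
Proof.
by move=> nB; rewrite /level /= (baseU nB) (bS nB) (aS nB) addSnnS.
Qed.

Let level_top x y : level x = level y -> B' (U x) -> B' (U y).
Proof.
move=> E /b0 bx; apply: b_top; rewrite -bx.
exact: (congr1 (fun v => v.1.2) (esym E)).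
Qed.

Let level_step x y : level x = level y -> ~ B' (U x) -> level (U x) = level (U y).
Proof.
move=> E nB; rewrite !levelU ?E // => /level_top; apply: contra_not nB => H.
by apply: H.
Qed.

Let level_inv x y : level x = level y -> ~ B' x ->
  level (hinv U x) = level (hinv U y).
Proof.
move=> E nB; have ax : a x <> 0%N.
  by have [+ _] := leastP (aP x); rewrite -/(a x) => + a0x; rewrite a0x.
have nB2 : ~ B' y.
  by move=> /a0 ay; apply: ax; rewrite -ay; exact: (congr1 (fun v => v.1.1) E).
have Ex := levelU (x := hinv U x); have Ey := levelU (x := hinv U y).
rewrite !hinvK in Ex Ey; have := E; rewrite Ex // Ey // => -[Ea Eb E1 E2].
have bx := bS (x := hinv U x); have by_ := bS (x := hinv U y).
rewrite !hinvK in bx by_; rewrite bx // by_ //= in Eb.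
rewrite /level; congr (_, _, (_, _)) => //; last by rewrite bx // by_ // Eb.
Qed.

Let level_lc : loccst level.
Proof.
move=> x; have cz k : continuous (ziter U k) by move=> y; exact: ziter_cts.
have la := least_near (fun k => preimage_clopen cB' (cz (- k%:Z)%R)) (aP x).
have lb := least_near (fun k => preimage_clopen cB' (cz (Posz k.+1))) (bP x).
have cV' i : clopen (V' i) by rewrite /V'; case: ifP.
pose q := ziter U (- (a x)%:Z)%R.
have lV j : loccst (fun y i => (i <= n)%N /\ V' i (iter j U (q y))).
  move=> y; have lc i : loccst (fun y => V' i (iter j U (q y))).
    have cq : continuous (iter j U \o q).
      move=> z; apply: (@continuous_comp _ _ _ q (iter j U)); first exact: cz.
      exact: iter_cts.
    exact: (loccst_cts cq (clopen_loccst (cV' i))).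
  apply: filterS (loccst_lt n.+1 y lc) => z E; apply/funext => i; apply/propext.
  by split=> -[iN]; rewrite E.
have lC := loccst_cts (cz (- (a x)%:Z)%R) (clopen_loccst cC1) x.
have lW := loccst_lt (a x + b x).+1 x lV.
near=> y.
have Ea : a y = a x by near: y.
have Eb : b y = b x by near: y.
have EC : C1 (q y) = C1 (q x) by near: y.
have EV j : (j < (a x + b x).+1)%N -> (fun i => (i <= n)%N /\ V' i (iter j U (q y))) =
    (fun i => (i <= n)%N /\ V' i (iter j U (q x))).
  by move: j; near: y.
rewrite /level /base Ea Eb -/(q y) -/(q x) EC; congr (_, (_, _)).
apply/funext => j; apply/funext => i; apply/propext; split=> -[jl il Vi]; split => //.
  by have := congr1 (fun f => f i) (EV j jl); rewrite /= => E;
    have [] : (i <= n)%N /\ V' i (iter j U (q x)) by rewrite -E.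
by have := congr1 (fun f => f i) (EV j jl); rewrite /= => E;
    have [] : (i <= n)%N /\ V' i (iter j U (q y)) by rewrite E.
Unshelve. all: by end_near. Qed.

Let level_V x y i : level x = level y -> (i <= n)%N -> V' i x -> V' i y.
Proof.
move=> E iN Vx; have Eb z : iter (a z) U (base z) = z.
  exact: (ziterKN U (Posz (a z)) z).
have Ea : a x = a y by exact: (congr1 (fun v => v.1.1) E).
have : (level x).2.2 (a x) i by rewrite /= leq_addr Eb.
by rewrite E /= Ea Eb => -[].
Qed.

(** The first clause says that [y] lies in the image by [U] of the level of [x]; it is read at
    [hinv U y] because the image of a top level is not a level. *)
Let Q x y := [/\ level (hinv U y) = level x, (B' (U x) \/ ~ B (U x) -> y = U x),
  (~ B' (U x) -> fwd T (h x) (h y)) & orb T x y].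

(* r is U except where U enters B without entering B': there, each level is sent
   onto the next one by a map that becomes a forward jump of T once carried by h. *)
Let exists_rho : exists r : homeo X X, forall x, Q x (r x).
Proof.
have [f [g [fg fQ]]] : phomeo_in Q [set: X] [set: X]; last first.
  by have [r rf] := phomeo_homeo fg; exists r => x; rewrite rf; apply: fQ.
have lcU : loccst (level \o hinv U) by apply: loccst_cts level_lc => x; exact: homeo_cts.
apply: (@phomeo_glue _ _ _ level (level \o hinv U)).
- by move=> x _; exact: level_lc.
- by move=> x _; exact: lcU.
move=> v; rewrite !setTI.
have [[x1 [vx1 Bx1 nB'x1]]|noB] := pselect (exists x, [/\ level x = v, B (U x) & ~ B' (U x)]).
  (* [S1] and [S2] are the images by [h] of a level and of its image by [U]; the conjugate of [U] by
     [h] sends one to the other along the orbits of [T]. The forward map obtained between them is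
     then carried back by [h]. *)
  pose S1 := hinv h @^-1` [set x | level x = v].
  pose S2 := hinv h @^-1` [set y | level (hinv U y) = v].
  have c1 : clopen S1 by apply/homeo_clopen/loccst_fiber.
  have c2 : clopen S2 by apply/homeo_clopen/loccst_fiber/lcU.
  have S1x : S1 (h x1) by rewrite /S1 /preimage /mkset homeoK.
  have [|f [g [fg ff]]] := phomeo_fwd_ex R hW hT c1 c2 S1x.
    pose e := hcomp h (hcomp U (hinv h)); exists e, (hinv e); split.
      have -> : S1 = e @^-1` S2.
        by apply/funext => y; rewrite /S1 /S2 /e /preimage /mkset /= !homeo_funK.
      exact: homeo_phomeo.
    move=> y _; rewrite -{1}(hinvK h y); apply: orb_trans (orb_sym (hh _)) _.
    exact: orb_trans (UT _) (hh _).
  exists (hinv h \o f \o h), (hinv h \o g \o h); split.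
    have -> : [set x | level x = v] = h @^-1` S1.
      by apply/funext => y; rewrite /S1 /preimage /mkset homeoK.
    have -> : [set x | (level \o hinv U) x = v] = h @^-1` S2.
      by apply/funext => y; rewrite /S2 /preimage /mkset homeoK.
    exact: phomeo_conj.
  move=> x lx; have S1hx : S1 (h x) by rewrite /S1 /preimage /mkset homeoK.
  have fx := ff _ S1hx; have S2f : S2 (f (h x)) := ph_f fg S1hx.
  have lxx : level x1 = level x by rewrite vx1.
  have nB' : ~ B' (U x) by move=> /level_top H; apply/nB'x1/H.
  have Bx : B (U x).
    have := @level_V (U x1) (U x) n (level_step lxx nB'x1) (leqnn n).
    by rewrite /V' eqxx; apply.
  split => /=.
  - by rewrite lx; exact: S2f.
  - by case.
  - by move=> _; rewrite hinvK.
  - apply: orb_trans (hh x) (orb_trans (fwd_orb fx) _); apply: orb_sym.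
    by rewrite -{2}(hinvK h (f (h x))); exact: hh.
exists U, (hinv U); split.
  have -> : [set x | level x = v] = U @^-1` [set x | (level \o hinv U) x = v].
    by apply/funext => y; rewrite /preimage /mkset /= homeo_funK.
  exact: homeo_phomeo.
move=> x lx; split => //; first by rewrite homeoK.
by move=> nB'; apply: hP => Bx; apply: noB; exists x.
Qed.

(* g maps each level to itself and intertwines U and r inside a column. It is
   normalized to be the identity on the bottom level, except in the columns over
   C1, where it is the identity on the top level: this is how both x0 and z0,
   which lie in different columns, are fixed. *)
Lemma step_column (x0 z0 : X) : B' x0 -> ~ C1 x0 -> U z0 = x0 ->
  (forall k : nat, (forall j : nat, (j < k)%N -> ~ B' (ziter U (- j%:Z)%R z0)) ->
    B' (ziter U (- k%:Z)%R z0) -> C1 (ziter U (- k%:Z)%R z0)) ->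
  exists g : homeo X X, [/\ g x0 = x0, g z0 = z0, forall x, orb T x (g x),
    (forall i x, (i < n)%N -> V i (g x) <-> V i x) &
    (forall x, ~ B (U x) -> g (U x) = U (g x)) /\
    (forall x, ~ B' (U x) -> fwd T (h (g x)) (h (g (U x))))].
Proof.
move=> Bx0 C1x0 Uz0 C1z0; have [r rQ] := exists_rho.
have rU x : level (hinv r x) = level (hinv U x).
  by have [+ _ _ _] := rQ (hinv r x); rewrite hinvK => ->.
have rl x : ~ B' (U x) -> level (r x) = level (U x).
  move=> nB; have [E _ _ _] := rQ x.
  have := @level_step (hinv U (r x)) x E; rewrite hinvK; apply.
  by rewrite -{1}(hinvK U (r x)) => /(level_top E).
(* Up to the top of the column, [r] and [U] climb through the same levels, whatever the starting
   points in a common level. *)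
have up k x y : level x = level y -> (k <= b x)%N ->
    level (iter k r x) = level (iter k U y) /\ level (iter k U x) = level (iter k U y).
  move=> E; elim: k => [//|k IH] kb; have [E1 E2] := IH (ltnW kb).
  have nB : ~ B' (U (iter k U x)) by have [_ /(_ k kb)] := leastP (bP x).
  have nB1 : ~ B' (U (iter k U y)) by move=> /(level_top (esym E2)).
  have nB2 : ~ B' (U (iter k r x)) by move=> /(level_top E1).
  split; last exact: level_step.
  by rewrite /= (rl _ nB2); exact: level_step.
have level_base x y : level x = level y -> B' x -> B' y.
  move=> E /a0 ax; have [+ _] := leastP (aP y); rewrite -/(a y).
  by rewrite -(congr1 (fun v => v.1.1) E : a x = a y) ax.
have down k x y : level x = level y -> (k <= a x)%N ->
    level (iter k (hinv r) x) = level (iter k (hinv U) y) /\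
    level (iter k (hinv U) x) = level (iter k (hinv U) y).
  move=> E; elim: k => [//|k IH] kb; have [E1 E2] := IH (ltnW kb).
  have nB : ~ B' (iter k (hinv U) x).
    have [_ /(_ k kb)] := leastP (aP x); rewrite -zitersn; exact.
  have nB1 : ~ B' (iter k (hinv U) y) by move=> /(level_base _ _ (esym E2)).
  have nB2 : ~ B' (iter k (hinv r) x) by move=> /(level_base _ _ E1).
  rewrite !iterS; split; last exact: level_inv.
  by rewrite rU; exact: level_inv.
have a_up k x : (k <= b x)%N -> a (iter k U x) = (a x + k)%N.
  elim: k => [|k IH] kb; first by rewrite addn0.
  rewrite iterS aS ?IH ?addnS //; first exact: ltnW.
  by have [_ /(_ k kb)] := leastP (bP x).
have b_down k x : (k <= a x)%N -> b (iter k (hinv U) x) = (b x + k)%N.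
  elim: k => [|k IH] kb; first by rewrite addn0.
  rewrite iterS bS hinvK ?IH ?addnS //; first exact: ltnW.
  have [_ /(_ k kb)] := leastP (aP x); rewrite -zitersn; exact.
(* The signed number of levels from the one where [g] is the identity up to [x]. *)
pose e x : int := if `[< C1 (base x) >] then (- (b x)%:Z)%R else a x.
have e_level x y : level x = level y -> e x = e y.
  move=> E; rewrite /e.
  have -> : C1 (base x) = C1 (base y) by exact: (congr1 (fun v => v.2.1) E).
  have -> : a x = a y by exact: (congr1 (fun v => v.1.1) E).
  by have -> : b x = b y by exact: (congr1 (fun v => v.1.2) E).
have eS x : ~ B' (U x) -> e (U x) = (e x + 1)%R.
  move=> nB; rewrite /e (baseU nB) (aS nB) (bS nB).
  by case: ifP => _; lia.
(* [g] follows [U] to the normalized level and comes back with [r]. *)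
pose g x := ziter r (e x) (ziter U (- e x)%R x).
pose g' x := ziter U (e x) (ziter r (- e x)%R x).
have UK k : cancel (iter k U) (iter k (hinv U)).
  by move=> x; rewrite -[LHS]/(ziter (hinv U) k _) zitersn; exact: (ziterNK U k%:Z x).
have KU k : cancel (iter k (hinv U)) (iter k U).
  by move=> x; rewrite -[X in iter k U X]/(ziter (hinv U) k _) zitersn; exact: (ziterKN U k%:Z x).
have lg x : level (g x) = level x.
  rewrite /g /e; case: ifP => _.
    rewrite opprK -zitersn.
    have [|-> _] := down (b x) (iter (b x) U x) _ erefl; last by rewrite UK.
    by rewrite a_up // leq_addl.
  rewrite -zitersn.
  have [|-> _] := up (a x) (iter (a x) (hinv U) x) _ erefl; last by rewrite KU.
  by rewrite b_down // leq_addl.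
have lg' x : level (g' x) = level x.
  rewrite /g' /e; case: ifP => _.
    rewrite opprK -zitersn.
    have [E _] := up (b x) x x erefl (leqnn _).
    have [|_ ->] := down (b x) _ _ E; last by rewrite UK.
    have -> : a (iter (b x) r x) = a (iter (b x) U x) by exact: (congr1 (fun v => v.1.1) E).
    by rewrite a_up // leq_addl.
  rewrite -zitersn.
  have [E _] := down (a x) x x erefl (leqnn _).
  have [|_ ->] := up (a x) _ _ E; last by rewrite KU.
  have -> : b (iter (a x) (hinv r) x) = b (iter (a x) (hinv U) x).
    exact: (congr1 (fun v => v.1.2) E).
  by rewrite b_down // leq_addl.
have gK : cancel g g'.
  move=> x; rewrite /g' (e_level _ _ (lg x)) /g ziterNK; exact: ziterKN.
have g'K : cancel g' g.
  move=> x; rewrite /g (e_level _ _ (lg' x)) /g' ziterNK; exact: ziterKN.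
have e_lc : loccst e by move=> x; apply: filterS (level_lc x) => y; exact: e_level.
have cg : continuous g.
  move=> x; apply: (@cts_near _ _ _ (ziter r (e x) \o ziter U (- e x)%R)).
    by apply: filterS (e_lc x) => y; rewrite /g => ->.
  apply: (@continuous_comp _ _ _ (ziter U (- e x)%R) (ziter r (e x))); exact: ziter_cts.
have cg' : continuous g'.
  move=> x; apply: (@cts_near _ _ _ (ziter U (e x) \o ziter r (- e x)%R)).
    by apply: filterS (e_lc x) => y; rewrite /g' => ->.
  apply: (@continuous_comp _ _ _ (ziter r (- e x)%R) (ziter U (e x))); exact: ziter_cts.
have gU x : ~ B' (U x) -> g (U x) = r (g x).
  move=> nB; rewrite /g (eS _ nB) zU1 ziterS; congr (r (ziter r _ (ziter U _ _))); lia.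
have nBg x : ~ B' (U x) -> ~ B' (U (g x)).
  by move=> nB /(level_top (lg x)).
exists (Homeo gK g'K cg cg'); split => //=.
- have bx : base x0 = x0 by rewrite /base a0.
  by rewrite /g /e bx asboolF // a0.
(* [z0] is on a top level, since its image [x0] lies in [B'], and the base of its column is in
   [C1]. *)
- have Cz : C1 (base z0).
    by have [Ba la] := leastP (aP z0); apply: C1z0.
  by rewrite /g /e asboolT // b0 // Uz0.
- move=> x; apply: orb_trans (orb_ziter _ _ UT) (orb_ziter _ _ _).
  by move=> y; have [] := rQ y.
- move=> i x iN; have VE : V i = V' i by rewrite /V' ltn_eqF.
  by rewrite VE; split; apply: level_V (ltnW iN) => //; rewrite lg.
split => x nB; last first.
  by rewrite gU //; have [_ _ + _] := rQ (g x); apply; exact: nBg.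
have nB' : ~ B' (U x) by move=> /B'B.
rewrite gU //; have [_ + _ _] := rQ (g x); apply; right => Bg; apply: nB.
(* [g] preserves levels, so [U (g x)] lies outside [B] with [U x], and there [r] is [U]. *)
have lxg : level (U (g x)) = level (U x) by apply: level_step (nBg x nB'); exact: lg.
by have := level_V lxg (leqnn n); rewrite /V' eqxx; apply.
Qed.

End Step.

Lemma metrizable_cantor_enum (R : realType) (X : topologicalType) :
  is_cantor_space R X -> exists W : nat -> set X, cantor_enum W.
Proof.
move=> [[x0 _] cX [M [h]] pX [_ bX]].
have cM : compact [set: M].
  have -> : [set: M] = h @` setT.
    by apply/seteqP; split => // y _; exists (hinv h y) => //; exact: hinvK.
  apply: continuous_compact => //; apply: continuous_subspaceT => x; exact: homeo_cts.
pose P : pseudoPMetricType R := HB.pack (M : Type) (isPointed.Build M (h x0)) (PseudoMetric.on M).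
have [f] := @clopen_surj R P cM.
(* The surjection onto the clopen sets may take other values, which are replaced by the empty
   set. *)
pose W n := if `[< clopen (h @^-1` (f n : set M)) >] then h @^-1` (f n : set M) else set0.
exists W; split => //.
- by move=> n; rewrite /W; case: asboolP => // _; exact: clopen0.
- move=> C cC; have [n _ fn] := @surj _ _ _ _ f (hinv h @^-1` C) (homeo_clopen (hinv h) cC).
  exists n; rewrite /W; have -> : h @^-1` (f n : set M) = C.
    by rewrite fn; apply/funext => x; rewrite /preimage /mkset homeoK.
  by rewrite asboolT.
- move=> x O oO Ox; have [C [cC Cx] CO] := bX x O (open_nbhs_nbhs (conj oO Ox)).
  by exists C; split.
- rewrite open_hausdorff => x y xy.
  have := @metric_hausdorff R M; rewrite open_hausdorff => /(_ (h x) (h y)).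
  case; first by apply: contra xy => /eqP /homeo_inj ->.
  move=> [A B] /= [Ax By] [oA oB AB]; exists (h @^-1` A, h @^-1` B) => /=.
    by rewrite !inE in Ax By *.
  split; [apply: open_comp => // z _; exact: homeo_cts|
    apply: open_comp => // z _; exact: homeo_cts|].
  apply/eqP/seteqP; split => // z [Az Bz].
  have : (A `&` B) (h z) by [].
  by rewrite (eqP AB).
- exact/perfectTP.
Qed.

(** * The limit conjugacy *)

Section Limit.
Variables (X : topologicalType) (W : nat -> set X).
Hypothesis hW : cantor_enum W.

(** The stage [N] is independent of [x]: this is uniform convergence expressed with clopen sets,
    hence the continuity of the limit. *)
Lemma stable_lim (f : nat -> X -> X) : (forall n, continuous (f n)) ->
  (forall C, clopen C -> exists N, forall n x, (N <= n)%N -> C (f n x) = C (f N x)) ->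
  exists l, continuous l /\
    forall C, clopen C -> exists N, forall n x, (N <= n)%N -> C (f n x) = C (l x).
Proof.
move=> cf st.
have /choice [l lP] : forall x, exists l, forall C, clopen C ->
    exists N, forall n, (N <= n)%N -> C (f n x) = C l.
  move=> x; apply: (cluster_lim hW) => C /st [N NP].
  by exists N => n; exact: NP.
have lst C : clopen C -> exists N, forall n x, (N <= n)%N -> C (f n x) = C (l x).
  move=> cC; have [N NP] := st C cC; exists N => n x Nn.
  have [N' N'P] := lP x C cC.
  by rewrite -(N'P (maxn n N')) ?leq_maxr // !NP // (leq_trans Nn) ?leq_maxl.
exists l; split => // x; apply: (cts_clopen hW) => C cC Clx.
have [N NP] := lst C cC.
apply: filterS (loccst_cts (cf N) (clopen_loccst cC) x) => y /= E.
by rewrite -(NP N) // E (NP N).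
Qed.

Lemma homeo_lim (h : nat -> homeo X X) :
  (forall C, clopen C -> exists N, forall n x, (N <= n)%N -> C (h n x) = C (h N x)) ->
  (forall C, clopen C -> exists N, forall n x, (N <= n)%N ->
    C (hinv (h n) x) = C (hinv (h N) x)) ->
  exists l : homeo X X,
    forall C, clopen C -> exists N, forall n x, (N <= n)%N -> C (h n x) = C (l x).
Proof.
move=> st st'.
have [l [cl lP]] := stable_lim (fun n x => @homeo_cts _ _ (h n) x) st.
have [k [ck kP]] := stable_lim (fun n x => @homeo_cts _ _ (hinv (h n)) x) st'.
have kK : cancel k l.
  move=> y; apply: (clopen_eq hW) => C cC; have [N NP] := lP C cC.
  (* With [N] fixed, the convergence of the inverses is tested on the preimage of [C] by [h N],
     where [h N] can be exchanged with any later map and with the limit. *)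
  have [M MP] := kP _ (homeo_clopen (h N) cC).
  have := MP (maxn N M) y (leq_maxr _ _); rewrite /preimage /mkset.
  by rewrite (NP N) // -(NP (maxn N M)) ?leq_maxl // hinvK NP // => ->.
have lK : cancel l k.
  move=> y; apply: (clopen_eq hW) => C cC; have [N NP] := kP C cC.
  have [M MP] := lP _ (homeo_clopen (hinv (h N)) cC).
  have := MP (maxn N M) y (leq_maxr _ _); rewrite /preimage /mkset.
  by rewrite (NP N) // -(NP (maxn N M)) ?leq_maxl // homeoK NP // => ->.
by exists (Homeo lK kK cl ck).
Qed.

End Limit.

Lemma fwd_ziter (X : topologicalType) (T : homeo X X) (m n : int) x :
  (m < n)%R -> fwd T (ziter T m x) (ziter T n x).
Proof.
move=> mn; exists `|n - m|.-1.
have E : n = (Posz (`|n - m|.-1).+1 + m)%R by lia.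
by rewrite {1}E ziterD.
Qed.

Section Start.
Variables (R : realType) (X : topologicalType) (W : nat -> set X) (T : homeo X X).
Hypotheses (hW : cantor_enum W) (hT : minimal_homeo T).

(** A clopen set [C] contains [z] but not [x]. Forward maps of [C] and of its complement onto
    themselves are glued, sending [z] to [y] and [x] to [y'], with [y'] chosen ahead of [y]. *)
Lemma start_homeo z x : z <> x -> orb T z x ->
  exists h : homeo X X, (forall y, orb T y (h y)) /\ fwd T (h z) (h x).
Proof.
move=> /(clopen_sep hW) [C [cC Cz nCx]] [k Ek].
have cC' := clopenC setT cC.
have [y [Cy zy]] := fwd_hit hW hT z (proj1 cC) Cz.
have [p Ep] := zy.
(* Starting beyond both [T^(p+1) z = y] and [T^k z = x] puts [y'] ahead of [y] and of [x]. *)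
have [y' [Cy' [q Eq]]] := fwd_hit hW hT (ziter T (Posz p.+1 + `|k|)%R z) (proj1 cC') nCx.
have Ey' : y' = ziter T (Posz q.+1 + (Posz p.+1 + `|k|))%R z by rewrite ziterD.
have yy' : fwd T y y'.
  by rewrite Ep Ey' -[iter _ _ _]/(ziter T (Posz p.+1) z); apply: fwd_ziter; lia.
have xy' : fwd T x y' by rewrite Ek Ey'; apply: fwd_ziter; lia.
have eqv (A : set X) : st_equiv R T A A by [].
pose Q u v := fwd T u v /\ ((u = z -> v = y) /\ (u = x -> v = y')).
have [f [g [fg fQ]]] : phomeo_in Q [set: X] [set: X].
  apply: (@phomeo_glue _ _ _ C C).
  - by move=> u _; exact: clopen_loccst.
  - by move=> u _; exact: clopen_loccst.
  move=> P; rewrite !setTI; have [PT|PF] := pselect P.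
    have -> : [set u | C u = P] = C.
      apply/seteqP; split => u /=; first by move=> ->.
      by move=> Cu; apply/propext.
    have [f [g [fg ff]]] := phomeo_fwd hW hT cC cC Cz Cy zy (eqv C).
    exists f, g; split => // u Cu; have [fu uz] := ff u Cu.
    by split => //; split => // ux; rewrite ux in Cu.
  have -> : [set u | C u = P] = ~` C.
    apply/seteqP; split => u /=; first by move=> ->.
    by move=> Cu; apply/propext; split => // /Cu.
  have [f [g [fg ff]]] := phomeo_fwd hW hT cC' cC' nCx Cy' xy' (eqv (~` C)).
  exists f, g; split => // u Cu; have [fu ux] := ff u Cu.
  by split => //; split => // uz; rewrite uz in Cu.
have [h hf] := phomeo_homeo fg; exists h; split => [u|]; rewrite ?hf.
  by apply: fwd_orb; have [] := fQ u I.
have [_ [-> // _]] := fQ z I; by have [_ [_ ->]] := fQ x I.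
Qed.

End Start.

(** * Iterated corrections and their limit *)

Section Speedup.
Variables (R : realType) (X : topologicalType) (W : nat -> set X) (T U : homeo X X).
Hypotheses (hW : cantor_enum W) (hT : minimal_homeo T).
Hypothesis UT : forall x y, orb U x y <-> orb T x y.

Lemma minimal_orb : minimal_homeo U.
Proof.
move=> x O O0 oO; have [y [Oy yo]] := hT x O0 oO; exists y; split => //.
by apply/zorbitP/UT/zorbitP.
Qed.

Let UT1 x : orb T x (U x). Proof. exact/UT/orb_step. Qed.

Variable x0 : X.
Let z0 := hinv U x0.

Let stage := ((homeo X X * set X) * seq (set X))%type.

Let inv (s : stage) := let: (h, B, L) := s in
  [/\ forall x, orb T x (h x), forall x, ~ B (U x) -> fwd T (h x) (h (U x)),
    clopen B /\ B x0 & forall i, clopen (nth setT L i)].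

(* The sets recorded in L are invariant under all later corrections g. *)
Let next (n : nat) (s s' : stage) := let: (h, B, L) := s in let: (h', B', L') := s' in
  exists g : homeo X X, [/\ forall x, h' x = h (g x), g x0 = x0 /\ g z0 = z0,
    forall i x, (i < size L)%N -> nth setT L i (g x) <-> nth setT L i x,
    forall x, ~ B (U x) -> g (U x) = U (g x) &
    B' = B `&` side (W n) x0 /\ L' = L ++ [:: W n; h' @^-1` W n; U @^-1` B']].

Let next_ex n s : inv s -> exists s', inv s' /\ next n s s'.
Proof.
case: s => [[h B] L] [hh hP [cB Bx0] cL].
pose B' := B `&` side (W n) x0.
have cB' : clopen B' by apply: clopenI => //; apply/side_clopen/(ce_clopen hW).
have B'x0 : B' x0 by split => //; exact: side_mem.
have B'B : B' `<=` B by move=> z [].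
(* [w] is the base of the column topped by [z0]. As [x0] is strictly ahead of it on its [U]-orbit, a
   clopen set [C1] can contain [w] and not [x0]. *)
pose P k := B' (ziter U (- k%:Z)%R z0); pose w := ziter U (- (least P)%:Z)%R z0.
have wx0 : w <> x0.
  apply: (aperiodic hW minimal_orb).
  exists (least P); rewrite -[iter _ _ _]/(ziter U (Posz (least P).+1) w) /w.
  by rewrite -addn1 addnC PoszD -ziterD -addrA subrr addr0 /= /z0 homeo_invK.
have [C1 [cC1 C1w nC1]] := clopen_sep hW wx0.
have [|g [gx gz go gL [gU gP]]] := @step_column R X W T U hW hT minimal_orb UT1
  h B B' C1 (size L) (nth setT L) hh hP cB cB' cC1 cL B'B (ex_intro _ x0 B'x0)
  x0 z0 B'x0 nC1 (hinvK U x0).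
  move=> k kl Bk; suff -> : k = least P by [].
  by apply/esym/least_eq.
pose h' := hcomp h g.
(* Preserving [W n] will make the inverses converge; preserving its preimage by [h'] will make the
   maps converge; preserving the preimage of [B'] by [U] will keep later corrections commuting with
   [U] where they should. *)
exists (h', B', L ++ [:: W n; h' @^-1` W n; U @^-1` B']); split; last by exists g; split.
split => //=.
- by move=> x; apply: orb_trans (go x) (hh _).
move=> i; rewrite nth_cat; case: ifP => _ //.
case: (i - size L)%N => [|[|[|j]]] /=; rewrite ?nth_nil.
- exact: (ce_clopen hW n).
- exact: (homeo_clopen h' (ce_clopen hW n)).
- exact: (homeo_clopen U cB').
- exact: clopenT.
Qed.

Lemma speedup_conjugacy : exists h : homeo X X, forall x, fwd T (h x) (h (U x)).
Proof.
have zx : z0 <> x0.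
  by apply: (aperiodic hW minimal_orb); exists 0%N; rewrite /= homeo_invK.
have [h0 [h0o h0f]] : exists h : homeo X X, (forall y, orb T y (h y)) /\ fwd T (h z0) (h x0).
  apply: (start_homeo R hW hT zx).
  by have := UT1 z0; rewrite /z0 hinvK.
have /choice [step stepP] : forall ns : nat * stage, exists s',
    inv ns.2 -> inv s' /\ next ns.1 ns.2 s'.
  move=> [n s]; have [is_|nis] := pselect (inv s); last by exists s => /nis.
  by have [s' s'P] := next_ex n is_; exists s'.
(* With [setT] as first set, the forward condition is vacuous at the start. *)
pose S := fix S n : stage := if n is k.+1 then step (k, S k) else ((h0, setT), [::]).
have SI n : inv (S n).
  elim: n => [|n IH]; last by have [] := stepP (n, S n) IH.
  split => [//|x nT|//|i]; first by case: nT.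
    by split => //; exact: clopenT.
  by rewrite /= nth_nil; exact: clopenT.
have SN n : next n (S n) (S n.+1) by have [] := stepP (n, S n) (SI n).
pose h n := (S n).1.1; pose B n := (S n).1.2; pose L n := (S n).2.
have hI n : [/\ forall x, orb T x (h n x), forall x, ~ B n (U x) -> fwd T (h n x) (h n (U x)),
    clopen (B n) /\ B n x0 & forall i, clopen (nth setT (L n) i)].
  by have := SI n; rewrite /inv /h /B /L; case: (S n) => [[]].
have /choice [g gP] : forall n, exists g : homeo X X,
   [/\ forall x, h n.+1 x = h n (g x), g x0 = x0 /\ g z0 = z0,
    forall i x, (i < size (L n))%N -> nth setT (L n) i (g x) <-> nth setT (L n) i x,
    forall x, ~ B n (U x) -> g (U x) = U (g x) &
    B n.+1 = B n `&` side (W n) x0 /\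
    L n.+1 = L n ++ [:: W n; h n.+1 @^-1` W n; U @^-1` B n.+1]].
  move=> n; have := SN n; rewrite /next /h /B /L.
  by case: (S n) => [[? ?] ?]; case: (S n.+1) => [[? ?] ?].
have hg n x : h n.+1 x = h n (g n x) by have [] := gP n.
have hig n x : hinv (h n) x = g n (hinv (h n.+1) x).
  by apply: (@homeo_inj _ _ (h n)); rewrite -hg !hinvK.
have BS n : B n.+1 `<=` B n by have [_ _ _ _ [-> _]] := gP n; move=> z [].
have Bm m n : (n <= m)%N -> B m `<=` B n.
  elim: m => [|m IH]; first by rewrite leqn0 => /eqP ->.
  rewrite leq_eqVlt => /predU1P [->//|nm] z Bz; apply: (IH nm); exact: BS.
have Lm m n C : (n <= m)%N -> (exists2 i, (i < size (L n))%N & nth setT (L n) i = C) ->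
    exists2 i, (i < size (L m))%N & nth setT (L m) i = C.
  elim: m => [|m IH]; first by rewrite leqn0 => /eqP ->.
  rewrite leq_eqVlt => /predU1P [->//|nm] H; have [i il iC] := IH nm H.
  exists i; have [_ _ _ _ [_ ->]] := gP m; first by rewrite size_cat ltn_addr.
  by rewrite nth_cat il.
have gL n m x C : (n <= m)%N -> (exists2 i, (i < size (L n))%N & nth setT (L n) i = C) ->
    C (g m x) = C x.
  move=> nm /(Lm m n C nm) [i il <-]; apply/propext.
  by have [_ _ + _ _] := gP m; apply.
have new n : [/\ exists2 i, (i < size (L n.+1))%N & nth setT (L n.+1) i = W n,
    exists2 i, (i < size (L n.+1))%N & nth setT (L n.+1) i = h n.+1 @^-1` W n &
    exists2 i, (i < size (L n.+1))%N & nth setT (L n.+1) i = U @^-1` B n.+1].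
  have [_ _ _ _ [_ ->]] := gP n; rewrite size_cat /=.
  split; [exists (size (L n))|exists (size (L n) + 1)%N|exists (size (L n) + 2)%N];
    rewrite ?ltn_add2l // ?nth_cat ?ltnn ?subnn //; last 2 first.
  - by rewrite ltnNge leq_addr addKn.
  - by rewrite ltnNge leq_addr addKn.
  by rewrite -{1}[size _]addn0 ltn_add2l.
have [|C cC|hl hlP] := homeo_lim hW (h := h).
- move=> C cC; have [n <-] := ce_surj hW cC; have [_ W2 _] := new n.
  exists n.+1 => m x; elim: m x => [//|m IH] x.
  rewrite leq_eqVlt => /predU1P [<-//|nm]; rewrite hg IH //.
  exact: (gL n.+1 m x _ nm W2).
- have [n <-] := ce_surj hW cC; have [W1 _ _] := new n.
  exists n.+1 => m x; elim: m x => [//|m IH] x.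
  rewrite leq_eqVlt => /predU1P [<-//|nm]; rewrite -IH // (hig m).
  by rewrite (gL n.+1 m _ _ nm W1).
have fixlim z : (forall n, g n z = z) -> hl z = h0 z.
  move=> gz; have hz n : h n z = h0 z by elim: n => [//|n IH]; rewrite hg gz.
  apply: (clopen_eq hW) => C cC; have [N NP] := hlP C cC.
  by rewrite -(NP N) // hz.
exists hl => x; have [Ux|Ux] := pselect (U x = x0).
  (* At [z0] and [x0] the limit equals [h0], which was chosen to put [h0 x0] ahead of [h0 z0]. *)
  have -> : x = z0 by apply: (@homeo_inj _ _ U); rewrite Ux /z0 hinvK.
  rewrite /z0 hinvK -/z0 !fixlim // => n; by have [_ [? ?] _ _ _] := gP n.
have [n nB] : exists n, ~ B n.+1 (U x).
  have /(clopen_sep hW) [C [cC Cx nC]] := nesym Ux.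
  have [n Wn] := ce_surj hW cC; exists n.
  by have [_ _ _ _ [-> _]] := gP n; rewrite side_sub Wn // => -[].
(* From stage [n.+1] on, the corrections commute with [U] at points that [U] sends outside [B n.+1],
   and keep such points among themselves. *)
have conj m y : (n.+1 <= m)%N -> ~ B n.+1 (U y) ->
    hinv (h n.+1) (h m (U y)) = U (hinv (h n.+1) (h m y)) /\
    ~ B n.+1 (U (hinv (h n.+1) (h m y))).
  elim: m y => [//|m IH] y; rewrite leq_eqVlt => /predU1P [<-|nm] nBy.
    by rewrite !homeoK.
  have nBg : ~ B n.+1 (U (g m y)).
    have [_ _ W3] := new n.
    by have E := gL n.+1 m y _ nm W3; rewrite /preimage /mkset in E; rewrite E.
  rewrite !hg; have [_ _ _ gU _] := gP m.
  by rewrite gU; [exact: IH|move=> /(Bm m n.+1 nm _)].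
pose e := hcomp (h n.+1) (hcomp U (hinv (h n.+1))).
have eE : hl (U x) = e (hl x).
  apply: (clopen_eq hW) => C cC; have [N NP] := hlP C cC.
  have [M MP] := hlP _ (homeo_clopen e cC).
  pose m := maxn n.+1 (maxn N M).
  have nm : (n.+1 <= m)%N by exact: leq_maxl.
  have := MP m x (leq_trans (leq_maxr N M) (leq_maxr _ _)).
  rewrite -(NP m) ?(leq_trans (leq_maxl N M) (leq_maxr _ _)) //.
  rewrite /preimage /mkset => <-.
  have [E _] := conj m x nm nB.
  by rewrite -[h m (U x)](hinvK (h n.+1)) E.
(* Avoiding a clopen set passes to the limit, so the invariant of stage [n.+1] applies and shows
   that [e] moves [hl x] forward. *)
have nBl : ~ B n.+1 (U (hinv (h n.+1) (hl x))).
  have cBn : clopen (B n.+1) by have [_ _ [] ] := hI n.+1.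
  have [N NP] := hlP _ (homeo_clopen (hinv (h n.+1)) (homeo_clopen U cBn)).
  have := NP (maxn n.+1 N) x (leq_maxr _ _); rewrite /preimage /mkset => <-.
  by have [] := conj (maxn n.+1 N) x (leq_maxl _ _) nB.
have [_ hf _ _] := hI n.+1.
by rewrite eE; have := hf _ nBl; rewrite hinvK.
Qed.

End Speedup.

Section Conjugacy.
Variables (X Y : topologicalType) (T : homeo X X) (S : homeo Y Y) (h : homeo X Y).
Hypothesis hTS : forall x, h (T x) = S (h x).

Lemma ziter_conj n x : h (ziter T n x) = ziter S n (h x).
Proof.
elim: n => [//|n IH|n IH]; first by rewrite -addn1 PoszD !ziterS hTS IH.
have -> : (- n.+1%:Z = - n%:Z - 1)%R by lia.
by rewrite !ziterP -IH; apply: (@homeo_inj _ _ S); rewrite -hTS !hinvK.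
Qed.

Lemma orb_conj x y : orb T x y <-> orb S (h x) (h y).
Proof.
split=> -[n E]; exists n; first by rewrite E ziter_conj.
by apply: (@homeo_inj _ _ h); rewrite E ziter_conj.
Qed.

Lemma minimal_conj : minimal_homeo T -> minimal_homeo S.
Proof.
move=> hT y O [z Oz] oO.
have oh : open (h @^-1` O) by apply: open_comp => // x _; exact: homeo_cts.
have hz : (h @^-1` O) (hinv h z) by rewrite /preimage /mkset hinvK.
have [n On] := orbit_hit hT (hinv h y) oh hz.
exists (h (ziter T n (hinv h y))); split => //.
by exists n; rewrite // ziter_conj hinvK.
Qed.

End Conjugacy.

Lemma orbit_equivalent_sym (X1 X2 : topologicalType) (T1 : homeo X1 X1)
  (T2 : homeo X2 X2) : orbit_equivalent T1 T2 -> orbit_equivalent T2 T1.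
Proof.
move=> [F FP]; exists (hinv F) => y; have := FP (hinv F y); rewrite hinvK => <-.
apply/seteqP; split => [_ [_ [x xo <-] <-]|x xo]; first by rewrite homeoK.
by exists (F x); [exists x|rewrite homeoK].
Qed.

Lemma orbit_equivalent_speedup (R : realType) (X1 X2 : topologicalType)
    (T1 : homeo X1 X1) (T2 : homeo X2 X2) :
  minimal_cantor_system R T1 -> orbit_equivalent T1 T2 -> is_speedup T2 T1.
Proof.
move=> [cX hT1] [F FP]; have [W hW] := metrizable_cantor_enum cX.
pose U := hcomp (hinv F) (hcomp T2 F).
have FU x : F (U x) = T2 (F x) by exact: hinvK.
(* [F] carries the orbits of [U], by conjugacy, and those of [T1], by orbit equivalence, onto the
   orbits of [T2]. *)
have UT x y : orb U x y <-> orb T1 x y.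
  split => [/(orb_conj FU) /zorbitP|/zorbitP o].
    by rewrite -FP => -[z zo /homeo_inj <-]; apply/zorbitP.
  by apply/(orb_conj FU)/zorbitP; rewrite -FP; exists y.
have [[x0 _] _ _ _ _] := cX.
have [h hP] := speedup_conjugacy R hW hT1 UT x0.
pose S := hcomp h (hcomp U (hinv h)).
have hS x : h (U x) = S (h x) by rewrite /S /= homeo_funK.
have /choice [p pP] : forall y, exists n : nat, S y = iter n.+1 T1 y.
  by move=> y; have := hP (hinv h y); rewrite hinvK => -[n E]; exists n.
exists S, (fun y => (p y).+1); split => //.
  exact: minimal_conj hS (minimal_orb hT1 UT).
exists (hcomp h (hinv F)) => y.
have -> : hcomp h (hinv F) (T2 y) = h (U (hinv F y)).
  by congr (h _); apply: (@homeo_inj _ _ F); rewrite FU !hinvK.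
exact: hS.
Qed.

Theorem corollary4p1 (R : realType) (X1 X2 : topologicalType)
  (T1 : homeo X1 X1) (T2 : homeo X2 X2)
  (hT1 : minimal_cantor_system R T1) (hT2 : minimal_cantor_system R T2) :
  orbit_equivalent T1 T2 -> speedup_equivalent T1 T2.
Proof.
move=> TT; split; last exact: orbit_equivalent_speedup hT1 TT.
exact: orbit_equivalent_speedup hT2 (orbit_equivalent_sym TT).
Qed.
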